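(* Let $p>3$ be a prime. Then $$\sum_{k=0}^{(p-1)/2}\frac{k^2\binom{2k}k^3}{(-8)^k}\equiv\begin{cases}\frac{10}{27}x^2-\frac49p\pmod{p^2}&\text{if } p\equiv1\pmod 4\text{ and } p=x^2+4y^2 \text{ with } x,y\in\mathbb Z,\\ \frac7{27}p+\frac1{18}R_1(p)\pmod{p^2}&\text{if } p\equiv 3\pmod 4,\end{cases}$$ $$\sum_{k=0}^{(p-1)/2}\frac{k^3\binom{2k}k^3}{(-8)^k}\equiv\begin{cases}-\frac4{81}x^2+\frac4{27}p\pmod{p^2}&\text{if } p\equiv1\pmod 4\text{ and } p=x^2+4y^2 \text{ with } x,y\in\mathbb Z,\\ -\frac{10}{81}p-\frac2{27}R_1(p)\pmod{p^2}&\text{if } p\equiv 3\pmod 4.\end{cases}$$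
   Context: For an odd prime $p$, $R_1(p)=(2p+2-2^{p-1})\binom{(p-1)/2}{[p/4]}^2$, where $[u]$ denotes the greatest integer not exceeding $u$. Congruences modulo $p^r$ between rational numbers with denominators prime to $p$ mean that the difference is $p^r$ times such a rational number. *)

(* Defs.v *)
From mathcomp Require Import all_boot all_order all_algebra.
Set Implicit Arguments. Unset Strict Implicit. Unset Printing Implicit Defensive.
Import Order.TTheory GRing.Theory Num.Theory.
Local Open Scope ring_scope.

Definition p_integral (p : nat) (c : rat) : bool := ~~ (p %| `|denq c|)%N.

Definition rat_congr (p r : nat) (a b : rat) : Prop :=
  exists c : rat, p_integral p c /\ a - b = (p ^ r)%N%:R * c.

Definition R1 (p : nat) : rat :=
  ((2 * p + 2)%N%:R - (2 ^ (p - 1))%N%:R) * ('C((p - 1) %/ 2, p %/ 4))%:R ^+ 2.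

Definition Ssum (j p : nat) : rat :=
  \sum_(0 <= k < ((p - 1) %/ 2).+1)
     (k%:R ^+ j * ('C(2 * k, k))%:R ^+ 3 / (-8) ^+ k).

(* Main.v *)
(* Let n = (p-1)/2 and f(w) = P_n(1+2w), with P_n the Legendre polynomial.
   Modulo p^2 the summand C(2k,k)^3/(-8)^k is C(n,k) C(n+k,k) C(2k,k) 2^k, and
   Clausen's identity f(w)^2 = sum_k C(n,k) C(n+k,k) C(2k,k) (w+w^2)^k at w = 1
   expresses the sums with weights 1, k, k^2 through f(1), f'(1); the weight k^3
   follows by telescoping.

   By Vandermonde, f(1) = F := sum_k C(n,k)^2 2^(n-k). The polynomial
   r(t) = sum_k C(n,k)^2 2^(n-k) (1-t)^k, for which r(0) = F, satisfies
     (k+2)(k+1) r_(k+2) = (n-k)^2 r_k + p (k+1) r_(k+1),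
   so that its coefficients of index not congruent to n mod 2 vanish modulo p and
   the others have a closed form modulo p^2. This determines r(0) (n even) or
   r'(0) (n odd); the Wronskian of r(t) and r(-t) determines the product r(0) r'(0).

   If n = 2m, it remains to show F^2 = 4x^2 - 2p modulo p^2. By Jacobsthal
   4x^2 = J^2 for the character sum J = sum_t (t^3-t | p). Summing over Teichmueller
   representatives t^p, with the Legendre symbol (y | p) = (3 y^n - y^(3n))/2 modulo
   p^2, expresses J through C(2m,m), C(6m,m) and C(6m,3m). *)
Require Import Defs.
From mathcomp Require Import all_boot all_order all_algebra.
From mathcomp Require Import cyclic finfield ring zify.
Set Implicit Arguments. Unset Strict Implicit. Unset Printing Implicit Defensive.
Import Order.TTheory GRing.Theory Num.Theory.
Local Open Scope ring_scope.

(** * Linear certificates for equations, and coefficients of polynomials *)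

Section PolynomialTools.
Variable R : comNzRingType.
Implicit Types a b c x y : R.

(** [lincomb1] to [lincomb5] derive an equation from known ones by an explicit linear combination,
    whose check is left to [ring]; no division occurs, so they apply in Z/p^2. *)
Lemma lincomb1 c a b x y : a = b -> x - y = c * (a - b) -> x = y.
Proof. by move=> -> h; apply: subr0_eq; rewrite h subrr mulr0. Qed.

Lemma lincomb2 c1 c2 a1 b1 a2 b2 x y : a1 = b1 -> a2 = b2 ->
  x - y = c1 * (a1 - b1) + c2 * (a2 - b2) -> x = y.
Proof. by move=> -> -> h; apply: subr0_eq; rewrite h !subrr !mulr0 addr0. Qed.

Lemma lincomb3 c1 c2 c3 a1 b1 a2 b2 a3 b3 x y :
  a1 = b1 -> a2 = b2 -> a3 = b3 ->
  x - y = c1 * (a1 - b1) + c2 * (a2 - b2) + c3 * (a3 - b3) -> x = y.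
Proof. by move=> -> -> -> h; apply: subr0_eq; rewrite h !subrr !mulr0 !addr0. Qed.

Lemma lincomb4 c1 c2 c3 c4 a1 b1 a2 b2 a3 b3 a4 b4 x y :
  a1 = b1 -> a2 = b2 -> a3 = b3 -> a4 = b4 ->
  x - y = c1 * (a1 - b1) + c2 * (a2 - b2) + c3 * (a3 - b3) + c4 * (a4 - b4) ->
  x = y.
Proof.
by move=> -> -> -> -> h; apply: subr0_eq; rewrite h !subrr !mulr0 !addr0.
Qed.

Lemma lincomb5 c1 c2 c3 c4 c5 a1 b1 a2 b2 a3 b3 a4 b4 a5 b5 x y :
  a1 = b1 -> a2 = b2 -> a3 = b3 -> a4 = b4 -> a5 = b5 ->
  x - y = c1 * (a1 - b1) + c2 * (a2 - b2) + c3 * (a3 - b3) + c4 * (a4 - b4)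
          + c5 * (a5 - b5) -> x = y.
Proof.
by move=> -> -> -> -> -> h; apply: subr0_eq; rewrite h !subrr !mulr0 !addr0.
Qed.

Lemma coefX_deriv (q : {poly R}) k : ('X * q^`())`_k = k%:R * q`_k.
Proof. by rewrite coefXM coef_deriv mulr_natl; case: k. Qed.

Lemma coef_derivE (q : {poly R}) k : q^`()`_k = k.+1%:R * q`_k.+1.
Proof. by rewrite coef_deriv mulr_natl. Qed.

Lemma coef_natM m (q : {poly R}) k : (m%:R * q)`_k = m%:R * q`_k.
Proof. by rewrite !mulr_natl coefMn. Qed.

(** With the subtraction taken in [R] the relation holds for every [k]: beyond [n] both binomials
    vanish. *)
Lemma binS_mul n k :
  k.+1%:R * 'C(n, k.+1)%:R = (n%:R - k%:R) * 'C(n, k)%:R :> R.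
Proof.
rewrite -natrM mul_bin_left natrM; case: (leqP k n) => h; first by rewrite natrB.
by rewrite bin_small // !mulr0.
Qed.

End PolynomialTools.

Lemma coef_1DcX_exp (R : comNzRingType) (c : R) m k :
  ((1 + c *: 'X) ^+ m)`_k = c ^+ k * 'C(m, k)%:R.
Proof.
have -> : (1 + c *: 'X) ^+ m = \poly_(i < m.+1) (c ^+ i * 'C(m, i)%:R).
  rewrite exprDn poly_def; apply: eq_bigr => i _.
  by rewrite expr1n mul1r exprZn mulr_natr scalerMnl.
by rewrite coef_poly ltnS; case: leqP => // h; rewrite bin_small // mulr0.
Qed.

(** * Sums of squared binomials *)

Section CentralPolynomial.
Variables (R : comNzRingType) (n : nat).

(* 2^n 2F1(-n,-n;1;v/2) *)
Definition sqbinp : {poly R} :=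
  \poly_(k < n.+1) ('C(n, k) ^ 2 * 2 ^ (n - k))%N%:R.

Lemma coef_sqbinp k : sqbinp`_k = ('C(n, k) ^ 2 * 2 ^ (n - k))%N%:R.
Proof.
by rewrite coef_poly ltnS; case: leqP => // h; rewrite bin_small // exp0n.
Qed.

Lemma coef_sqbinpS k :
  2 * k.+1%:R ^+ 2 * sqbinp`_k.+1 = (n%:R - k%:R) ^+ 2 * sqbinp`_k.
Proof.
rewrite !coef_sqbinp !natrM !natrX.
have := binS_mul R n k; set a := 'C(n, k.+1)%:R; set b := 'C(n, k)%:R => h.
case: (ltnP k n) => hk.
  have -> : (n - k = (n - k.+1).+1)%N by lia.
  (* A difference of squares: one factor is [h], the other stands in [c]. *)
  apply: (lincomb1 (c := 2 * 2 ^+ (n - k.+1) * (k.+1%:R * a + (n%:R - k%:R) * b)) h).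
  by rewrite (exprS _ (n - k.+1)); ring.
have -> : a = 0 by rewrite /a bin_small.
move: h; rewrite /a bin_small // mulr0 => h.
by apply: (lincomb1 (c := - 2 ^+ (n - k) * ((n%:R - k%:R) * b)) (esym h)); ring.
Qed.

(** The hypergeometric equation: through X d/dX, [coef_sqbinpS] becomes an identity of
    polynomials. *)
Lemma sqbinp_ode : let T := sqbinp in
  'X * (2 - 'X) * T^`()^`() + (2 - (1 - 2 * n%:R) * 'X) * T^`() = n%:R ^+ 2 * T.
Proof.
move=> T.
have h : 2%:R * ('X * T^`()^`()) + 2%:R * T^`() + (2 * n)%N%:R * ('X * T^`())
   = 'X * ('X * T^`())^`() + (n ^ 2)%N%:R * T.
  apply/polyP => k.
  rewrite !coefD !coef_natM !coefX_deriv !coef_derivE.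
  apply: (lincomb1 (c := 1) (coef_sqbinpS k)).
  by rewrite -/T !natrM; ring.
apply: (lincomb1 (c := 1) h).
by rewrite !derivM derivX natrM natrX; ring.
Qed.

(* v = 1 - t: the evaluation point v = 1 becomes the centre of symmetry t = 0 *)
Definition ctrp : {poly R} := sqbinp \Po (1 - 'X).

Lemma deriv_comp1X (q : {poly R}) : (q \Po (1 - 'X))^`() = - (q^`() \Po (1 - 'X)).
Proof. by rewrite deriv_comp derivB derivX derivC; ring. Qed.

(** The singular points v = 0 and v = 2 move to t = 1 and t = -1. The coefficient [2 * n.+1%:R - 1]
    is 2n + 1, later the prime p. *)
Lemma ctrp_ode : let r := ctrp in
  (1 - 'X ^+ 2) * r^`()^`()
  = ((2 * n.+1%:R - 1) + (1 - 2 * n%:R) * 'X) * r^`() + n%:R ^+ 2 * r.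
Proof.
move=> r.
have := congr1 (fun q => q \Po (1 - 'X)) sqbinp_ode.
rewrite /= !comp_polyD !comp_polyM !comp_polyB !comp_polyX /= !comp_polyM.
rewrite !comp_polyB !comp_polyM -!polyC_natr -polyC1 !comp_polyC !polyC_natr polyC1
  !comp_polyX => h.
rewrite /r /ctrp !deriv_comp1X derivN deriv_comp1X.
by apply: (lincomb1 (c := 1) h); ring.
Qed.

Lemma ctrp_sum :
  ctrp = \sum_(k < n.+1) sqbinp`_k *: (1 + (-1) *: 'X) ^+ k.
Proof.
rewrite /ctrp scaleN1r comp_polyE.
have hs : (size sqbinp <= n.+1)%N by apply: size_poly.
rewrite (big_ord_widen _ (fun k => sqbinp`_k *: (1 - 'X) ^+ k) hs) big_mkcond.
by apply: eq_bigr => k _; case: ltnP => // h; rewrite nth_default // scale0r.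
Qed.

Lemma coef_ctrp j :
  ctrp`_j = \sum_(k < n.+1) sqbinp`_k * ((-1) ^+ j * 'C(k, j)%:R).
Proof.
by rewrite ctrp_sum coef_sum; apply: eq_bigr => k _; rewrite coefZ coef_1DcX_exp.
Qed.

Lemma coef_ctrp_gt j : (n < j)%N -> ctrp`_j = 0.
Proof.
move=> h; rewrite coef_ctrp big1 // => k _; rewrite bin_small ?mulr0 //.
exact: leq_ltn_trans (leq_ord k) h.
Qed.

Lemma lead_ctrp : ctrp`_n = (-1) ^+ n.
Proof.
rewrite coef_ctrp big_ord_recr big1 /= => [|k _]; last first.
  by rewrite bin_small ?mulr0.
by rewrite coef_sqbinp !binn subnn add0r mul1r mulr1.
Qed.

Lemma size_ctrp : (size ctrp <= n.+1)%N.
Proof. by apply/leq_sizeP => j; apply: coef_ctrp_gt. Qed.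

(** Only the term with the factor 2n + 1, later equal to p, links indices of opposite parity. *)
Lemma coef_ctrp_rec k :
  k.+2%:R * k.+1%:R * ctrp`_k.+2
  = (n%:R - k%:R) ^+ 2 * ctrp`_k + (2 * n.+1%:R - 1) * k.+1%:R * ctrp`_k.+1.
Proof.
have h : ctrp^`()^`() = 'X * ('X * ctrp^`())^`() + (2 * n).+1%:R * ctrp^`()
     + (n * n)%N%:R * ctrp
     - (2 * n)%N%:R * ('X * ctrp^`()).
  apply: (lincomb1 (c := 1) ctrp_ode).
  by rewrite !derivM derivX; ring.
have := congr1 (fun q : {poly R} => q`_k) h.
rewrite /= !(coefD, coefN) !coef_natM !coefX_deriv !coef_derivE => hk.
apply: (lincomb1 (c := 1) hk).
ring.
Qed.

Lemma ctrp0 : ctrp.[0] = sqbinp.[1].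
Proof. by rewrite horner_comp !hornerE subr0. Qed.

Lemma ctrp1 : ctrp.[1] = 2 ^+ n.
Proof.
rewrite horner_comp !hornerE subrr horner_coef0 coef_sqbinp bin0 subn0 mul1n.
by rewrite natrX.
Qed.

Lemma deriv_ctrp0 : ctrp^`().[0] = - sqbinp^`().[1].
Proof. by rewrite deriv_comp1X hornerN horner_comp !hornerE subr0. Qed.

End CentralPolynomial.

Lemma coef_compN (R : comNzRingType) (q : {poly R}) k :
  (q \Po - 'X)`_k = (-1) ^+ k * q`_k.
Proof.
have -> : q \Po - 'X = \poly_(i < size q) ((-1) ^+ i * q`_i).
  rewrite comp_polyE poly_def; apply: eq_bigr => i _.
  by rewrite -scaleN1r exprZn scalerA mulrC.
by rewrite coef_poly; case: ltnP => // h; rewrite nth_default ?mulr0.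
Qed.

(** * Clausen's identity for Legendre polynomials *)

Lemma central_binS k : (k.+1 * 'C(2 * k.+1, k.+1) = 2 * (2 * k).+1 * 'C(2 * k, k))%N.
Proof.
have h1 := mul_bin_diag (2 * k).+1 k.
have h2 := mul_bin_down (2 * k).+1 k.
rewrite (_ : 2 * k.+1 = (2 * k).+2)%N; last by lia.
rewrite -mul_bin_diag /=; rewrite /= in h2.
rewrite (_ : (2 * k).+1 - k = k.+1)%N in h2; last by lia.
by lia.
Qed.

Section Clausen.
Variables (R : comNzRingType) (n : nat).

(* P_n(1 + 2 w), with P_n the Legendre polynomial *)
Definition legp : {poly R} := \poly_(k < n.+1) ('C(n, k) * 'C(n + k, k))%:R.

Definition clausenp : {poly R} :=
  \poly_(k < n.+1) ('C(n, k) * 'C(n + k, k) * 'C(2 * k, k))%:R.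

Lemma coef_legp k : legp`_k = ('C(n, k) * 'C(n + k, k))%:R.
Proof. by rewrite coef_poly ltnS; case: leqP => // h; rewrite bin_small. Qed.

Lemma coef_clausenp k : clausenp`_k = ('C(n, k) * 'C(n + k, k) * 'C(2 * k, k))%:R.
Proof. by rewrite coef_poly ltnS; case: leqP => // h; rewrite bin_small. Qed.

Lemma bin_addS k :
  k.+1%:R * 'C(n + k.+1, k.+1)%:R = (n + k).+1%:R * 'C(n + k, k)%:R :> R.
Proof. by rewrite addnS -!natrM -mul_bin_diag. Qed.

(** The ratio of consecutive coefficients rests on (n - k)(n + k + 1) = n(n + 1) - k(k + 1). *)
Lemma coef_legpS k :
  k.+1%:R ^+ 2 * legp`_k.+1 = (n%:R * n.+1%:R - k%:R * k.+1%:R) * legp`_k.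
Proof.
rewrite !coef_legp !natrM.
apply: (lincomb2 (c1 := k.+1%:R * 'C(n + k.+1, k.+1)%:R)
  (c2 := (n%:R - k%:R) * 'C(n, k)%:R) (binS_mul R n k) (bin_addS k)).
by ring.
Qed.

Lemma coef_clausenpS k :
  k.+1%:R ^+ 3 * clausenp`_k.+1 =
  2 * (2 * k).+1%:R * (n%:R * n.+1%:R - k%:R * k.+1%:R) * clausenp`_k.
Proof.
have h : k.+1%:R * 'C(2 * k.+1, k.+1)%:R = 2 * (2 * k).+1%:R * 'C(2 * k, k)%:R :> R.
  by rewrite -natrM central_binS !natrM.
have := coef_legpS k; rewrite !coef_legp => h1.
rewrite !coef_clausenp !(natrM _ (_ * _)%N).
apply: (lincomb2 (c1 := k.+1%:R * 'C(2 * k.+1, k.+1)%:R)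
  (c2 := (n%:R * n.+1%:R - k%:R * k.+1%:R) * ('C(n, k) * 'C(n + k, k))%:R) h1 h).
by ring.
Qed.

(** Both sides equal the multinomial n! / (i! (k-i)! (n-k)!). *)
Lemma bin_trade i k : (i <= k)%N -> (k <= n)%N ->
  ('C(n, k) * 'C(k, i) = 'C(n, i) * 'C(n - i, k - i))%N.
Proof.
move=> hi hk.
have h1 := bin_fact hk; have h2 := bin_fact hi.
have h3 := bin_fact (leq_trans hi hk).
have h4 : (k - i <= n - i)%N by lia.
have := bin_fact h4; rewrite (_ : n - i - (k - i) = n - k)%N; last by lia.
move=> h5.
have hpos : (0 < i`! * (k - i)`! * (n - k)`!)%N by rewrite !muln_gt0 !fact_gt0.
apply/eqP; rewrite -(eqn_pmul2r hpos); apply/eqP.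
transitivity n`!; first by rewrite -h1 -h2; ring.
by rewrite -h3 -h5; ring.
Qed.

(** Vandermonde's identity expands C(n+k,k), and [bin_trade] regroups the binomials. At w = 1 the
    terms become those of [sqbinp] at 1. *)
Lemma legp_sqbin :
  legp = \sum_(i < n.+1) ('C(n, i) ^ 2)%:R *: ('X^i * (1 + 'X) ^+ (n - i)).
Proof.
apply/polyP => k; rewrite coef_legp coef_sum.
transitivity (\sum_(i < n.+1) ('C(n, k) * ('C(n, i) * 'C(k, i)))%:R : R).
  rewrite -natr_sum -big_distrr /=; congr (_ * _)%:R.
  rewrite addnC -bin_sub ?leq_addr // addKn -binomial.Vandermonde.
  by apply: eq_bigr => i _; rewrite mulnC bin_sub // -ltnS.
apply: eq_bigr => i _; rewrite coefZ coefXnM.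
have hi : (i <= n)%N by rewrite -ltnS.
case: ltnP => hki; first by rewrite [X in ('C(n, k) * (_ * X))%N]bin_small // !muln0 mulr0.
rewrite -['X]scale1r coef_1DcX_exp expr1n mul1r -natrM; congr _%:R.
case: (leqP k n) => hk; first by rewrite mulnCA bin_trade // mulnA.
have e : 'C(n - i, k - i) = 0%N by apply: bin_small; lia.
by rewrite e (bin_small hk) muln0.
Qed.

Lemma legp1 : legp.[1] = (sqbinp R n).[1].
Proof.
rewrite legp_sqbin horner_sum /sqbinp horner_poly; apply: eq_bigr => i _.
by rewrite !hornerE /= !expr1n !mulr1 natrM (natrX _ 2).
Qed.

(** At w = 1, twice the derivative of w^i (1 + w)^(n-i) is (n + i) 2^(n-i). *)
Lemma deriv_legp1 : 2 * legp^`().[1] = (sqbinp R n)^`().[1] + n%:R * (sqbinp R n).[1].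
Proof.
rewrite legp_sqbin /sqbinp poly_def !raddf_sum /= !horner_sum !mulr_sumr -big_split.
apply: eq_bigr => i _ /=.
rewrite !derivZ derivM !derivXn deriv_exp !derivE !hornerE /= !expr1n !mulr1.
have hi : (i <= n)%N by rewrite -ltnS.
rewrite hornerMn horner_exp hornerMn horner_exp !hornerE /= expr1n.
set d := (n - i)%N; have -> : n%:R = (i + d)%N%:R :> R by rewrite subnKC.
rewrite -[1 + 1]/(2 : R); set c := ('C(n, i) ^ 2)%N.
by case: d => [|d] /=; rewrite natrM natrX ?exprS; ring.
Qed.

Lemma legp_ode : let X : {poly R} := 'X + 'X ^+ 2 in
  X * legp^`()^`() + (1 + 2 * 'X) * legp^`() = (n * n.+1)%N%:R * legp.
Proof.
move=> X.
have h : 'X * legp^`()^`() + legp^`() + 'X * ('X * legp^`())^`() + 'X * legp^`()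
         = (n * n.+1)%N%:R * legp.
  apply/polyP => k.
  rewrite !coefD !coef_natM !coefX_deriv !coef_derivE.
  by apply: (lincomb1 (c := 1) (coef_legpS k)); ring.
by apply: (lincomb1 (c := 1) h); rewrite !derivM derivX /X; ring.
Qed.

(* [X d/dX] applied to both sides is the ODE of [clausenp] *)
Lemma clausenp_ode : let f1 := 'X * clausenp^`() in let f2 := 'X * f1^`() in
  ((1 + 4 * 'X) * f2 + 2 * 'X * f1 - 2 * (n * n.+1)%N%:R * 'X * clausenp)^`()
  = 2 * (n * n.+1)%N%:R * f1.
Proof.
move=> f1 f2; set N := (n * n.+1)%N.
have h : f2^`() + 4%:R * (f2 + 'X * f2^`()) + 2%:R * (f1 + 'X * f1^`())
   = (4 * N)%N%:R * f1 + (2 * N)%N%:R * clausenp.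
  apply/polyP => k.
  rewrite /f2 /f1 !(coefD, coef_natM, coefX_deriv, coef_derivE).
  by apply: (lincomb1 (c := 1) (coef_clausenpS k)); rewrite /N; ring.
apply: (lincomb1 (c := 1) h).
have nat0 m : (m%:R : {poly R})^`() = 0 by rewrite -polyC_natr derivC.
have d1 : (1 : {poly R})^`() = 0 by apply: derivC.
by rewrite !(derivM, derivD, derivN, derivX) !nat0 !d1 /f2 /f1 !derivM derivX; ring.
Qed.

Local Notation X := ('X + 'X ^+ 2 : {poly R}).
Local Notation N := ((n * n.+1)%N%:R : {poly R}).

(* The symmetric square of the Legendre equation *)
Definition sqode (g : {poly R}) : {poly R} :=
  (X * ((X * g^`())^`() - 2 * N * g))^`() - 2 * N * X * g^`().

Lemma derivXX : X^`() = 1 + 2 * 'X.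
Proof. by rewrite expr2 derivD derivM derivX; ring. Qed.

(* With [X f'' + X' f' = N f]: [(X^2 f'^2)' = 2 (X f') (X f')' = N X (f^2)'] *)
Lemma sqode_legp : sqode (legp ^+ 2) = 0.
Proof.
have o := legp_ode; rewrite /= in o; set f := legp in o *.
have d1 : (1 : {poly R})^`() = 0 by apply: derivC.
have e : (X * (f ^+ 2)^`())^`() - 2 * N * f ^+ 2 = 2 * X * f^`() ^+ 2.
  apply: (lincomb1 (c := 2 * f) o).
  by rewrite !expr2 !(derivM, derivD, derivX); ring.
rewrite /sqode e.
apply: (lincomb1 (c := 4 * X * f^`()) o).
by rewrite !expr2 !(derivM, derivD, derivX) !d1; ring.
Qed.

(** With Z = w + w^2, (dZ/dw)^2 = (1 + 2w)^2 = 1 + 4Z, so the chain rule turns [clausenp_ode] into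
    the symmetric-square equation. *)
Lemma sqode_clausenp : sqode (clausenp \Po X) = 0.
Proof.
have o := clausenp_ode; rewrite /= in o; set g := clausenp in o *.
have d1 : (1 : {poly R})^`() = 0 by apply: derivC.
have natc m : (m%:R : {poly R}) \Po X = m%:R by rewrite -polyC_natr comp_polyC.
have dXX : (1 + 2 * 'X : {poly R})^`() = 2.
  by rewrite !(derivM, derivD, derivX) !d1; ring.
have compX (q : {poly R}) : ('X * q) \Po X = X * (q \Po X).
  by rewrite comp_polyM comp_polyX.
set f1 := 'X * g^`() in o; set f2 := 'X * f1^`() in o.
have e1 : X * (g \Po X)^`() = (f1 \Po X) * X^`().
  by rewrite deriv_comp /f1 compX; ring.
have e2 : X * (X * (g \Po X)^`())^`() = (f2 \Po X) * X^`() ^+ 2 + 2 * X * (f1 \Po X).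
  by rewrite e1 derivM deriv_comp derivXX dXX /f2 compX; ring.
pose b := (1 + 4 * 'X) * f2 + 2 * 'X * f1 - 2 * N * 'X * g.
have e3 : X * ((X * (g \Po X)^`())^`() - 2 * N * (g \Po X)) = b \Po X.
  rewrite mulrBr e2 derivXX /b comp_polyB comp_polyD !comp_polyM comp_polyD.
  by rewrite comp_polyM !natc !comp_polyX; ring.

rewrite /sqode e3 deriv_comp {1}/b o comp_polyM comp_polyM !natc.
by apply: (lincomb1 (c := - 2 * N) e1); ring.
Qed.
Lemma sqodeB g1 g2 : sqode (g1 - g2) = sqode g1 - sqode g2.
Proof.
pose I g : {poly R} := X * ((X * g^`())^`() - 2 * N * g).
have hI : I (g1 - g2) = I g1 - I g2.
  by rewrite /I derivB [X * (g1^`() - _)]mulrBr derivB; ring.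
by rewrite /sqode -!/(I _) hI !derivB; ring.
Qed.

End Clausen.

(** A power series argument: index k of the equation reads (k+1)^3 g_(k+1) plus a combination of g_k
    and g_(k-1), so g_0 = 0 forces the next coefficients to vanish one after the other as long as k
    + 1 is invertible. *)
Lemma sqode_eq0 (K : comUnitRingType) n m (g : {poly K}) :
  (forall k, (0 < k <= m)%N -> (k%:R : K) \is a GRing.unit) ->
  (size g <= m.+1)%N -> g`_0 = 0 -> sqode n g = 0 -> g = 0.
Proof.
move=> hu hs g0 hg.
suff g_eq0 k : (k <= m)%N -> forall j, (j <= k)%N -> g`_j = 0.
  apply/polyP => k; rewrite coef0; case: (leqP k m) => hk; first exact: (g_eq0 k).
  by rewrite nth_default // (leq_trans hs).
elim: k => [|k IH] hk j; first by rewrite leqn0 => /eqP ->.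
rewrite leq_eqVlt ltnS => /orP[/eqP ->|]; last by apply: IH; rewrite ltnW.
have {}IH := IH (ltnW hk).
set N := (n * n.+1)%N.
have [a defa] : exists a, a = 'X * g^`() by exists ('X * g^`()).
have [h defh] : exists h, h = (a + 'X * a)^`() - (2 * N)%N%:R * g.
  by exists ((a + 'X * a)^`() - (2 * N)%N%:R * g).
have e : ('X * h + 'X * ('X * h))^`() = (2 * N)%N%:R * (a + 'X * a).
  have e1 : ('X + 'X ^+ 2) * g^`() = a + 'X * a by rewrite defa; ring.
  have e2 : ('X * h + 'X * ('X * h)) = ('X + 'X ^+ 2) * h by ring.
  move: hg; rewrite /sqode e1 -/N => hg; rewrite e2 defh.
  have -> : (2 * N)%N%:R = 2 * N%:R :> {poly K} by rewrite natrM.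
  apply: (lincomb1 (c := 1) hg); rewrite defa; ring.
have := congr1 (fun q : {poly K} => q`_k) e.
have ha j' : a`_j' = j'%:R * g`_j' by rewrite defa coefX_deriv.
have hh j' : h`_j' = j'.+1%:R * (j'.+1%:R * g`_j'.+1 + j'%:R * g`_j')
    - (2 * N)%N%:R * g`_j'.
  by rewrite defh coefB coef_natM coef_derivE coefD coefXM /= !ha.
rewrite /= coef_derivE coef_natM !coefD !coefXM /= !ha hh.
have -> : (if k == 0%N then 0 else h`_k.-1) = 0.
  case: k IH {hk hh} (hh) => //= k IH hh.
  by rewrite hh !IH // !mulr0 ?addr0 ?subr0 ?mulr0.
have -> : (if k == 0%N then 0 else k.-1%:R * g`_k.-1) = 0.
  by case: k IH {hk} => //= k IH; rewrite IH ?mulr0.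
rewrite (IH k) // !mulr0 !addr0 subr0 mulr0 => h0.
have uk : (k.+1%:R : K) \is a GRing.unit by apply: hu.
by apply: (mulrI uk); apply: (mulrI uk); apply: (mulrI uk); rewrite h0 !mulr0.
Qed.

(** * Jacobsthal sums *)

Section QuadraticCharacter.
Variables (F : finFieldType) (n : nat).
Hypotheses (card_F : #|F| = (2 * n).+1).

Lemma expf_card_nz (x : F) : x != 0 -> x ^+ (2 * n) = 1.
Proof.
move=> x0; apply: (mulfI x0); rewrite -exprS -card_F mulr1; exact: expf_card.
Qed.

Lemma n_gt0 : (0 < n)%N.
Proof.
case: (posnP n) => // n0; have := card_F; rewrite n0 muln0 => h.
by have := finNzRing_gt1 F; rewrite h.
Qed.

Lemma primitive_exists : {g : F | (2 * n).-primitive_root g}.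
Proof.
pose rs := enum [pred x : F | x != 0].
have hall : all (2 * n).-unity_root rs.
  by apply/allP => x; rewrite mem_enum => /= x0; apply/unity_rootP/expf_card_nz.
have hsize : (2 * n <= size rs)%N.
  rewrite -cardE; have := cardC (pred1 (0 : F)); rewrite card1 card_F.
  by rewrite add1n => -[<-]; apply/eq_leq/eq_card.
have n2 : (0 < 2 * n)%N by rewrite muln_gt0 n_gt0.
have := has_prim_root n2 hall (enum_uniq _) hsize.
by have [/hasP/sig2W[g _ hg]|] := boolP (has _ rs) => // _; exists g.
Qed.

Lemma primitive_element :
  {g : F | g ^+ n = -1 & forall x, x != 0 -> exists i, x = g ^+ i}.
Proof.
have [g hg] := primitive_exists.
exists g => [|x x0]; last first.
  have [i ->] := prim_rootP hg (expf_card_nz x0); by exists i.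
have : (g ^+ n) ^+ 2 = 1 by rewrite -exprM mulnC; apply: prim_expr_order.
move/eqP; rewrite sqrf_eq1 => /orP[|/eqP //].
by rewrite -(prim_order_dvd hg) => /dvdn_leq; have := n_gt0; lia.
Qed.

Lemma expf_half (x : F) : x != 0 -> x ^+ n = 1 \/ x ^+ n = -1.
Proof.
move=> x0; have := expf_card_nz x0; rewrite mulnC exprM => /eqP.
by rewrite sqrf_eq1 => /orP[] /eqP; [left|right].
Qed.

(** If -1 = 1, all 2n nonzero elements would be roots of X^n - 1, which has at most n roots. *)
Lemma neg1_neq1 : (-1 : F) != 1.
Proof.
apply/eqP => h; have [g hg _] := primitive_element.
have hall (x : F) : x != 0 -> x ^+ n = 1 by move/expf_half; rewrite h => -[].
pose rs := enum [pred x : F | x != 0].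
have n0 := n_gt0.
have := max_unity_roots n0 _ (enum_uniq [pred x : F | x != 0]).
rewrite -/rs => /(_ _) H.
have : (size rs <= n)%N.
  by apply: H; apply/allP => x; rewrite mem_enum => /= x0; apply/unity_rootP/hall.
rewrite /rs -cardE; have := cardC (pred1 (0 : F)); rewrite card1 card_F add1n => -[e].
rewrite (_ : #|_| = 2 * n)%N; first by lia.
by rewrite -e; apply: eq_card.
Qed.

(** The quadratic character, defined through Euler's criterion; its values lie in [int] so that
    parity arguments apply to its sums. *)
Definition qchar (x : F) : int :=
  if x == 0 then 0 else if x ^+ n == 1 then 1 else -1.

Lemma qchar0 : qchar 0 = 0. Proof. by rewrite /qchar eqxx. Qed.

Lemma qchar1 : qchar 1 = 1. Proof. by rewrite /qchar oner_eq0 expr1n eqxx. Qed.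

Lemma qcharM x y : qchar (x * y) = qchar x * qchar y.
Proof.
rewrite /qchar mulf_eq0; case: eqP => [|/eqP x0] /=; first by rewrite mul0r.
case: eqP => [|/eqP y0] /=; first by rewrite mulr0.
rewrite exprMn; have n1 := negbTE neg1_neq1.
by case: (expf_half x0) => ->; case: (expf_half y0) => ->;
  rewrite ?mulrNN ?mulr1 ?mul1r ?eqxx ?n1.
Qed.

Lemma qchar_sqr x : x != 0 -> qchar x ^+ 2 = 1.
Proof.
by move=> x0; rewrite /qchar (negbTE x0); case: ifP; rewrite ?sqrrN expr1n.
Qed.

Lemma qchar_nonresidue g : g ^+ n = -1 -> g != 0 /\ qchar g = -1.
Proof.
move=> hg; have g0 : g != 0.
  apply/eqP => h; move/eqP: hg; rewrite h expr0n gtn_eqF ?n_gt0 //.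
  by rewrite eq_sym oppr_eq0 oner_eq0.
by rewrite /qchar (negbTE g0) hg (negbTE neg1_neq1).
Qed.

Lemma qchar_cases g x : g ^+ n = -1 -> (forall x, x != 0 -> exists i, x = g ^+ i) ->
  x != 0 -> exists r, r != 0 /\
    (x = r ^+ 2 /\ qchar x = 1 \/ x = g * r ^+ 2 /\ qchar x = -1).
Proof.
move=> hg hgen x0; have [i hi] := hgen x x0.
have [g0 qg] := qchar_nonresidue hg.
have q2 r : r != 0 -> qchar (r ^+ 2) = 1.
  by move=> r0; rewrite expr2 qcharM -expr2 qchar_sqr.
have h2 := odd_double_half i; rewrite -muln2 in h2.
move: hi; rewrite -{}h2; set j := i./2; set b := odd i => hi.
exists (g ^+ j); rewrite expf_neq0 //; split => //.
rewrite -exprM hi; case: b {hi}; [right|left].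
  by rewrite exprD expr1; split => //; rewrite qcharM qg exprM q2 ?expf_neq0.
by rewrite add0n; split => //; rewrite exprM q2 ?expf_neq0.
Qed.

Lemma sum_qchar : \sum_x qchar x = 0.
Proof.
have [g hg _] := primitive_element.
have [g0 qg] := qchar_nonresidue hg.
have : \sum_x qchar x = - \sum_x qchar x.
  rewrite {1}(reindex_inj (mulfI g0)) /= -mulN1r mulr_sumr.
  by apply: eq_bigr => x _; rewrite qcharM qg.
by lia.
Qed.

(** After k -> a - k the argument is k(k + d) with d = b - a. For nonzero d and k its character is
    that of 1 + d/k, which takes every value except 1. *)
Lemma sum_qchar_quad (a b : F) :
  \sum_k qchar ((a - k) * (b - k)) = (if a == b then (2 * n)%N%:R else -1).
Proof.
rewrite (reindex_inj (inj_comp (addrI a) oppr_inj)) /=.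
pose d := b - a.
rewrite (eq_bigr (fun k => qchar (k * (k + d)))); last first.
  move=> k _; congr qchar; rewrite /d; ring.
case: eqP => [hab|/eqP hab].
  have d0 : d = 0 by rewrite /d hab subrr.
  rewrite (bigD1 0) //= mul0r qchar0 add0r.
  under eq_bigr => k k0 do rewrite d0 addr0 -expr2.
  rewrite (eq_bigr (fun=> 1)); last first.
    by move=> k k0; rewrite expr2 qcharM -expr2 qchar_sqr.
  rewrite sumr_const; have := cardC (pred1 (0 : F)); rewrite card1 card_F add1n => -[<-].
  by congr (_ *+ _); apply: eq_card.
have d0 : d != 0 by rewrite subr_eq0 eq_sym.
rewrite (bigD1 0) //= mul0r qchar0 add0r.
have e k : k != 0 -> qchar (k * (k + d)) = qchar (1 + d * k^-1).
  move=> k0; rewrite (_ : k * (k + d) = k ^+ 2 * (1 + d * k^-1)); last first.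
    by apply: (lincomb1 (c := - (k * d)) (mulfV k0)); ring.
  by rewrite qcharM expr2 qcharM -expr2 qchar_sqr // mul1r.
rewrite (eq_bigr _ e).
have := sum_qchar.
(* Since [0^-1 = 0], [h] is a bijection of [F] with [h 0 = 1]; the term of index 0 is then
   removed. *)
pose h (k : F) := 1 + d * k^-1.
have hinj : injective h by move=> u v /addrI /(mulfI d0) /invr_inj.
rewrite (reindex_inj hinj) (bigD1 0) //= /h invr0 mulr0 addr0 qchar1 => h0.
by apply/eqP; rewrite -addr_eq0 addrC h0.
Qed.

Definition jacobsthal (k : F) : int := \sum_x qchar (x * (x ^+ 2 - k)).

Lemma jacobsthal0 : jacobsthal 0 = 0.
Proof.
rewrite -[RHS]sum_qchar; apply: eq_bigr => x _; rewrite subr0.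
have [->|x0] := eqVneq x 0; first by rewrite mul0r.
by rewrite qcharM expr2 qcharM -expr2 qchar_sqr // mulr1.
Qed.

Lemma jacobsthalM r k : r != 0 -> jacobsthal (k * r ^+ 2) = qchar r * jacobsthal k.
Proof.
move=> r0; rewrite /jacobsthal (reindex_inj (mulfI r0)) /= mulr_sumr.
apply: eq_bigr => x _.
rewrite (_ : r * x * ((r * x) ^+ 2 - k * r ^+ 2) = r ^+ 2 * (r * (x * (x ^+ 2 - k)))).
  by rewrite qcharM expr2 qcharM -expr2 qchar_sqr // mul1r qcharM.
by ring.
Qed.

Hypothesis n_even : ~~ odd n.

Lemma qcharN1 : qchar (-1) = 1.
Proof. by rewrite /qchar oppr_eq0 oner_eq0 -signr_odd (negbTE n_even) eqxx. Qed.

Lemma qcharN x : qchar (- x) = qchar x.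
Proof. by rewrite -mulN1r qcharM qcharN1 mul1r. Qed.

(** Expanding the square and summing over k first with [sum_qchar_quad] leaves only the pairs y = x
    and y = -x; the constant parts cancel by [sum_qchar]. *)
Lemma sum_jacobsthal_sqr : \sum_k jacobsthal k ^+ 2 = (2 * (2 * n).+1 * (2 * n))%N%:R.
Proof.
have e k : jacobsthal k ^+ 2
    = \sum_x \sum_y qchar (x * y) * qchar ((x ^+ 2 - k) * (y ^+ 2 - k)).
  rewrite expr2 mulr_suml; apply: eq_bigr => x _; rewrite mulr_sumr.
  by apply: eq_bigr => y _; rewrite !qcharM; ring.
rewrite (eq_bigr _ (fun k _ => e k)) exchange_big /=.
transitivity (\sum_x \sum_y (qchar (x * y) * (if x ^+ 2 == y ^+ 2 then (2 * n).+1%:R else 0)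
    - qchar x * qchar y)).
  apply: eq_bigr => x _; rewrite exchange_big /=; apply: eq_bigr => y _.
  rewrite -mulr_sumr sum_qchar_quad -qcharM.
  by case: eqP => _; ring.
have e0 : \sum_x \sum_y qchar x * qchar y = 0.
  transitivity ((\sum_x qchar x) * (\sum_y qchar y)); last by rewrite sum_qchar mul0r.
  by rewrite mulr_suml; apply: eq_bigr => x _; rewrite mulr_sumr.
under eq_bigr do rewrite sumrB; rewrite sumrB e0 subr0.
rewrite (bigD1 0) //= big1 ?add0r; last by move=> y _; rewrite mul0r qchar0 mul0r.
rewrite (eq_bigr (fun=> (2 * (2 * n).+1)%N%:R)).
  rewrite sumr_const; have := cardC (pred1 (0 : F)); rewrite card1 card_F add1n => -[h].
  rewrite (_ : #|_| = 2 * n)%N; last by rewrite -h; apply: eq_card.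
  by rewrite -mulrnA.
move=> x x0 /=.
have xN : - x != x.
  apply: contraNneq neg1_neq1 => h; apply/eqP/(mulIf x0); by rewrite mulN1r mul1r.
rewrite (bigD1 x) //= (bigD1 (- x)) //= big1 => [|y /andP[yx yNx]]; last first.
  rewrite eqf_sqr eq_sym (negbTE yx) -eqr_oppLR eq_sym (negbTE yNx) mulr0 //.
rewrite sqrrN eqxx mulrN qcharM -expr2 qchar_sqr // qcharN qcharM -expr2 qchar_sqr //.
by ring.
Qed.

(** For nonzero k the squared sum takes one value on squares and one on nonsquares; this is written
    with [qchar k], whose sum vanishes, and compared with the total. *)
Lemma jacobsthal_sum : exists g, jacobsthal 1 ^+ 2 + jacobsthal g ^+ 2 = 4 * (2 * n).+1%:R.
Proof.
have [g hg hgen] := primitive_element; exists g.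
set a := jacobsthal 1 ^+ 2; set b := jacobsthal g ^+ 2.
have n0 := n_gt0.
have h k : k != 0 -> 2 * jacobsthal k ^+ 2 = (a + b) + qchar k * (a - b).
  move=> k0; have [r [r0 [[-> ->]|[-> ->]]]] := qchar_cases hg hgen k0.
    by rewrite -[r ^+ 2]mul1r jacobsthalM // exprMn qchar_sqr // /a; ring.
  by rewrite jacobsthalM // exprMn qchar_sqr // /b; ring.
have : 2 * \sum_k jacobsthal k ^+ 2 = (2 * n)%N%:R * (a + b).
  rewrite (bigD1 0) //= jacobsthal0 expr0n /= add0r mulr_sumr (eq_bigr _ h).
  rewrite big_split /= -mulr_suml.
  have -> : \sum_(i | i != 0) qchar i = 0.
    by have := sum_qchar; rewrite (bigD1 0) //= qchar0 add0r.
  rewrite mul0r addr0 sumr_const; have := cardC (pred1 (0 : F)); rewrite card1 card_F add1n.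
  move=> -[h']; rewrite (_ : #|_| = 2 * n)%N; last by rewrite -h'; apply: eq_card.
  by rewrite mulr_natl.
rewrite sum_jacobsthal_sqr => e.
have n2 : (2 * n)%N%:R != 0 :> int by rewrite pnatr_eq0; lia.
apply: (mulfI n2); rewrite -e; ring.
Qed.

(* [H] contains exactly one of x and -x for each nonzero x *)
Lemma sum_even_half : exists H : pred F, forall f : F -> int,
  (forall x, f (- x) = f x) -> \sum_(x | x != 0) f x = 2 * \sum_(x | H x) f x.
Proof.
pose lt (x y : F) := (enum_rank x < enum_rank y)%N.
exists (fun x => lt x (- x)) => f hf.
have xN (x : F) : x != 0 -> enum_rank x != enum_rank (- x).
  move=> x0; apply: contraNneq neg1_neq1 => /enum_rank_inj h; apply/eqP/(mulIf x0).
  by rewrite mulN1r mul1r.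
rewrite (bigID (fun x => lt x (- x))) /= [X in _ + X](reindex_inj oppr_inj) /=.
have e1 x : (x != 0) && lt x (- x) = lt x (- x).
  by case: eqP => // ->; rewrite oppr0 /lt ltnn.
have e2 x : (- x != 0) && ~~ lt (- x) (- - x) = lt x (- x).
  rewrite opprK oppr_eq0 /lt -leqNgt; case: eqP => [->|/eqP/xN].
    by rewrite oppr0 ltnn.
  by rewrite leq_eqVlt /= -val_eqE /= => /negbTE ->.
by rewrite (eq_bigl _ _ e1) (eq_bigl _ _ e2) (eq_bigr _ (fun x _ => hf x)); ring.
Qed.

(** The summand is even, and is 1 or -1 outside 0, 1, -1. Half of the sum therefore has n - 1
    nonzero terms, an odd number; [w] marks those equal to -1. *)
Lemma jacobsthal_mod4 : exists j : int, jacobsthal 1 = 4 * j + 2.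
Proof.
pose f (x : F) := qchar (x * (x ^+ 2 - 1)).
have fN x : f (- x) = f x by rewrite /f sqrrN mulNr qcharN.
have [H hH] := sum_even_half.
have hS : jacobsthal 1 = 2 * \sum_(x | H x) f x.
  by rewrite -hH // /jacobsthal (bigD1 0) //= mul0r qchar0 add0r.
pose w (x : F) : int := if f x == -1 then 1 else 0.
have fw x : f x = f x ^+ 2 - 2 * w x.
  by rewrite /w /f /qchar; case: ifP => // _; case: ifP.
have hu : 2 * \sum_(x | H x) f x ^+ 2 = (2 * n)%N%:R - 2.
  rewrite -hH => [|x]; last by rewrite fN.
  have N1 := neg1_neq1.
  have N0 : (-1 : F) != 0 by rewrite oppr_eq0 oner_eq0.
  rewrite (bigD1 1) ?oner_eq0 //= (bigD1 (-1)) /=; last by rewrite N0 N1.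
  rewrite {1 2}/f !expr1n sqrrN expr1n subrr !mulr0 qchar0 expr0n !add0r.
  rewrite (eq_bigr (fun=> 1)) => [|x /andP[/andP[x0 x1] xN]]; last first.
    rewrite /f qchar_sqr // mulf_neq0 // subr_eq0 -[1](expr1n _ 2) eqf_sqr.
    by rewrite negb_or x1 xN.
  have := cardC (pred1 (0 : F)); rewrite card1 card_F add1n => -[h].
  have : \sum_(x : F | x != 0) (1 : int) = (2 * n)%N%:R.
    by rewrite sumr_const -h; congr (_ *+ _); apply: eq_card.
  rewrite (bigD1 1) ?oner_eq0 //= (bigD1 (-1)) /=; last by rewrite N0 N1.
  by move=> <-; ring.
exists ((n./2)%:R - 1 - \sum_(x | H x) w x).
rewrite hS (eq_bigr _ (fun x _ => fw x)) sumrB -mulr_sumr mulrBr hu.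
have := odd_double_half n; rewrite (negbTE n_even) add0n => {1}<-.
by rewrite -muln2; ring.
Qed.

End QuadraticCharacter.

(* (u x + 2 c y)^2 + (2 u y - c x)^2 = p^2, and the parity of u x excludes
   u x + 2 c y = 0 *)
Lemma two_squares_unique (p : nat) (u c x y : int) : prime p ->
  p%:R = u ^+ 2 + c ^+ 2 -> p%:R = x ^+ 2 + 4 * y ^+ 2 ->
  (exists j, u = 2 * j + 1) -> (exists j, x = 2 * j + 1) -> u ^+ 2 = x ^+ 2.
Proof.
move=> hp hu hx [j hj] [i hi].
have P0 : 0 < p%:R :> int by rewrite ltr0n prime_gt0.
(* The prime divides (2uy - cx)(2uy + cx) = p(u^2 - x^2), hence one factor; changing y to -y
   exchanges them up to sign. *)
have key y' : p%:R = x ^+ 2 + 4 * y' ^+ 2 ->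
    (p%:R %| 2 * u * y' - c * x)%Z -> u ^+ 2 = x ^+ 2.
  move: P0 hu; set P : int := p%:R => P0 hu hy /dvdzP[t ht].
  have h1 : (u * x + 2 * c * y') ^+ 2 = P ^+ 2 * (1 - t ^+ 2).
    apply: (lincomb3 (c1 := - (2 * u * y' - c * x) - t * P)
      (c2 := - (x ^+ 2 + 4 * y' ^+ 2)) (c3 := - P) ht hu hy).
    by ring.
  have t1 : 0 <= 1 - t ^+ 2.
    by rewrite -(pmulr_rge0 _ (exprn_gt0 2 P0)) -h1 sqr_ge0.
  have [t0|t0] := eqVneq t 0.
    have : P * (u ^+ 2 - x ^+ 2) = 0.
      move: ht; rewrite t0 mul0r => ht.
      apply: (lincomb3 (c1 := 2 * u * y' + c * x) (c2 := - x ^+ 2) (c3 := u ^+ 2) ht hu hy).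
      by ring.
    by move/eqP; rewrite mulf_eq0 gt_eqF //= subr_eq0 => /eqP.
  have t2 : 1 - t ^+ 2 = 0.
    have : 0 < t ^+ 2 by rewrite exprn_even_gt0.
    by move: (t ^+ 2) t1 => s; lia.
  move: h1; rewrite t2 mulr0 => /eqP; rewrite sqrf_eq0 => /eqP; rewrite hj hi => h.
  have : 2 * (2 * i * j + i + j + c * y') + 1 = 0 by rewrite -h; ring.
  by move: (_ + c * y') => k; lia.
have : (p%:R %| (2 * u * y - c * x) * (2 * u * y + c * x))%Z.
  apply/dvdzP; exists (u ^+ 2 - x ^+ 2); apply/esym.
  by apply: (lincomb2 (c1 := - x ^+ 2) (c2 := u ^+ 2) hu hx); ring.
rewrite dvdzE natz abszM Euclid_dvdM // => /orP[h|h].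
  by apply: (key y); rewrite // dvdzE natz.
apply: (key (- y)); first by rewrite hx; ring.
rewrite (_ : 2 * u * - y - c * x = - (2 * u * y + c * x)); last by ring.
by rewrite dvdzE abszN natz.
Qed.
(** * Computations modulo p^2 *)

(* [K] stands for Z/p^2 *)
Section ModuloSquare.
Variables (K : comUnitRingType) (p n : nat).
Hypotheses (p_prime : prime p) (p_eq : p = (2 * n).+1) (n_gt1 : (1 < n)%N).
Hypothesis psq0 : p%:R ^+ 2 = 0 :> K.
Hypothesis unit_nat : forall k, ~~ (p %| k)%N -> (k%:R : K) \is a GRing.unit.

Lemma unit_lt k : (0 < k < p)%N -> (k%:R : K) \is a GRing.unit.
Proof. by case/andP => h0 hp; apply: unit_nat; rewrite gtnNdvd. Qed.

Lemma unit2 : (2 : K) \is a GRing.unit.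
Proof. by apply: unit_lt; rewrite p_eq; lia. Qed.

(** Multiplying by p is how congruences modulo p are expressed inside [K]. *)
Lemma mulp_mod a b : a = b %[mod p] -> p%:R * a%:R = p%:R * b%:R :> K.
Proof.
have aux c : p%:R * c%:R = p%:R * (c %% p)%:R :> K.
  rewrite {1}(divn_eq c p) natrD natrM.
  by apply: (lincomb1 (c := (c %/ p)%:R) psq0); ring.
by move=> h; rewrite aux h -aux.
Qed.

Lemma fermat_mulp a : ~~ (p %| a)%N -> p%:R * a%:R ^+ (p - 1) = p%:R :> K.
Proof.
move=> ha; apply: (mulIr (unit_nat ha)).
rewrite -mulrA -exprSr subn1 prednK ?prime_gt0 // -natrX.
exact/mulp_mod/fermat_little.
Qed.

Lemma p_eqE : 2 * n.+1%:R - 1 = p%:R :> K.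
Proof. by rewrite p_eq; ring. Qed.

Lemma n_eqE : 2 * n%:R = p%:R - 1 :> K.
Proof. by rewrite -p_eqE; ring. Qed.

Lemma mulp_pow4 : p%:R * 2 ^+ n * 2 ^+ n = p%:R :> K.
Proof.
rewrite -mulrA -exprD (_ : n + n = p - 1)%N; last by rewrite p_eq; lia.
by rewrite (@fermat_mulp 2) // gtnNdvd // p_eq; lia.
Qed.

(** * Coefficients of r(t) modulo p^2, and the Wronskian *)

Local Notation r := (ctrp K n).
Local Notation F := ((sqbinp K n).[1]).
Local Notation F1 := ((sqbinp K n)^`().[1]).

(** Descending induction from r_(n+1) = 0: modulo p the recurrence gives (n-k)^2 r_k from r_(k+2),
    and n - k lies strictly between 0 and p, hence is a unit. *)
Lemma coef_ctrp_oppn i k : (k + i.*2.+1)%N = n -> exists z, r`_k = p%:R * z.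
Proof.
elim: i k => [|i IH] k hk; have := coef_ctrp_rec K n k; rewrite p_eqE.
  have hn : n = k.+1 by rewrite -hk addn1.
  rewrite coef_ctrp_gt ?hn // => h; exists (- k.+1%:R * (ctrp K k.+1)`_k.+1).
  by apply: (lincomb1 (c := -1) h); ring.
have [|z ->] := IH k.+2; first by rewrite -hk; lia.
have -> : n%:R - k%:R = i.+1.*2.+1%:R :> K by rewrite -[in n%:R]hk natrD; ring.
set u := (i.+1.*2.+1%:R : K); set r1 := r`_k.+1 => h.
have hu : u ^+ 2 \is a GRing.unit.
  by rewrite unitrX // unit_lt // p_eq -[in (2 * n)%N]hk; lia.
exists ((k.+2%:R * k.+1%:R * z - k.+1%:R * r1) / u ^+ 2).
rewrite mulrA; apply: (canRL (mulrK hu)).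
by apply: (lincomb1 (c := -1) h); ring.
Qed.

Lemma coef_ctrp_opp k : odd (n + k) -> exists z, r`_k = p%:R * z.
Proof.
move=> hodd; case: (ltnP n k) => hk.
  by exists 0; rewrite mulr0 coef_ctrp_gt.
apply: (@coef_ctrp_oppn (n - k)./2).
by have := odd_double_half (n - k); rewrite oddB // -oddD hodd; lia.
Qed.

Lemma mulp_coef_ctrp_opp k : odd (n + k) -> p%:R * r`_k = 0.
Proof. by case/coef_ctrp_opp => z ->; rewrite mulrA -expr2 psq0 mul0r. Qed.

Lemma mulp_ctrpN : p%:R * (r \Po - 'X) = p%:R * (-1) ^+ n * r.
Proof.
apply/polyP => k; rewrite -signr_odd -mulrA !coef_natM coef_compN.
have -> : ((-1) ^+ odd n * r)`_k = (-1) ^+ odd n * r`_k.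
  by case: (odd n); rewrite ?mul1r ?mulN1r ?coefN.
case hodd : (odd (n + k)).
  by rewrite !mulrA [p%:R * _]mulrC [p%:R * _ in RHS]mulrC -!mulrA
             mulp_coef_ctrp_opp // !mulr0.
rewrite -[(-1) ^+ k]signr_odd.
by move: hodd; rewrite oddD; case: (odd n); case: (odd k).
Qed.

(* Modulo p, s(t) := r(-t) is (-1)^n r(t); hence the polynomial
   U := (1 - t^2) (r s' - s r') + p (-1)^n r^2, of degree at most p, has zero
   derivative, so U = U_0 + U_p t^p. Compare the values at 1, -1 and 0. *)
Lemma wronskian : 2 * F * F1 = p%:R * (-1) ^+ n * (1 - F ^+ 2).
Proof.
pose s := r \Po - 'X; pose e : {poly K} := (-1) ^+ n.
have P2 : p%:R ^+ 2 = 0 :> {poly K} by rewrite -[p%:R]polyC_natr -polyC_exp psq0.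
have Pe : 2 * n.+1%:R - 1 = p%:R :> {poly K} by rewrite p_eq; ring.
have ns : s^`() = - (r^`() \Po - 'X).
  by rewrite deriv_comp derivN derivX; ring.
have nns : s^`()^`() = r^`()^`() \Po - 'X.
  by rewrite ns derivN deriv_comp derivN derivX; ring.
have o1 := ctrp_ode K n; rewrite /= Pe in o1.
have o2 : (1 - 'X ^+ 2) * s^`()^`()
   = (- p%:R + (1 - 2 * n%:R) * 'X) * s^`() + n%:R ^+ 2 * s.
  have compC m : (m%:R : {poly K}) \Po - 'X = m%:R by rewrite -polyC_natr comp_polyC.
  have := congr1 (fun q => q \Po - 'X) o1; rewrite /= nns ns -/s.
  rewrite comp_polyM comp_polyB (compC 1%N) expr2 comp_polyM comp_polyX.
  rewrite [RHS]comp_polyD !comp_polyM comp_polyD comp_polyM comp_polyB comp_polyM.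
  rewrite (compC 1%N) (compC 2%N) !compC comp_polyX -/s => h.
  by apply: (lincomb1 (c := 1) h); ring.
have Ps : p%:R * s = p%:R * e * r by exact: mulp_ctrpN.
have Ps' : p%:R * s^`() = p%:R * e * r^`().
  have e0 : e^`() = 0 by rewrite /e -signr_odd; case: odd; rewrite ?derivN derivC ?oppr0.
  have := congr1 (fun q => q^`()) Ps.
  by rewrite !derivM e0 -[p%:R]polyC_natr derivC !(mul0r, mulr0, add0r).
pose W := (1 - 'X ^+ 2) * (r * s^`() - s * r^`()); pose U := W + p%:R * e * r ^+ 2.
have dU : U^`() = 0.
  have e0 : e^`() = 0 by rewrite /e -signr_odd; case: odd; rewrite ?derivN derivC ?oppr0.
  have p0 : (p%:R : {poly K})^`() = 0 by rewrite -[p%:R]polyC_natr derivC.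
  rewrite /U /W expr2 !(derivM, derivD, derivN, derivX, derivC) e0 p0.
  apply: (lincomb5 (c1 := r) (c2 := - s) (c3 := - 'X * (r * s^`() - s * r^`()))
    (c4 := - (1 + 'X) * r) (c5 := - (1 - 'X) * r^`()) o2 o1 Pe Ps' Ps).
  by ring.
(* Below p, k U_k = 0 with k a unit; above p, the degree bound applies. Only the index p escapes
   both. *)
have cU k : (0 < k)%N -> (k != p)%N -> U`_k = 0.
  move=> k0 kp; case: (ltnP k p) => hk; last first.
    have sd (q : {poly K}) : (size q <= n.+1 -> size q^`() <= n)%N.
      move/leq_sizeP => hq; apply/leq_sizeP => j hj.
      by rewrite coef_derivE hq ?mulr0.
    have sr : (size r <= n.+1)%N by exact: size_ctrp.
    have ss : (size s <= n.+1)%N.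
      apply/leq_sizeP => j hj.
      by rewrite coef_compN (leq_sizeP _ _ sr) ?mulr0.
    have sM (q1 q2 : {poly K}) a b c : (size q1 <= a)%N -> (size q2 <= b)%N ->
        ((a + b).-1 <= c)%N -> (size (q1 * q2)%R <= c)%N.
      by move=> h1 h2; apply: leq_trans; apply: leq_trans (size_polyMleq _ _) _; lia.
    have sB (q1 q2 : {poly K}) c : (size q1 <= c)%N -> (size q2 <= c)%N ->
        (size (q1 - q2)%R <= c)%N.
      move=> h1 h2; apply: leq_trans (size_polyD _ _) _.
      by rewrite size_polyN geq_max h1.
    apply: (leq_sizeP _ p.+1); last by lia.
    rewrite /U -[_ * e * _]opprK; apply: (sB).
      apply: (sM _ _ 3%N (2 * n)%N); last by lia.
        by apply: sB; rewrite ?size_poly1 ?size_polyXn.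
      by apply: sB; [apply: (sM _ _ n.+1 n) | apply: (sM _ _ n.+1 n)];
        rewrite ?sd //; lia.
    rewrite size_polyN /e -signr_odd -polyC_natr.
    have -> : (-1) ^+ odd n = ((-1) ^+ odd n)%:P :> {poly K}.
      by case: odd; rewrite ?expr1 ?polyCN.
    apply: (sM _ _ 1%N (2 * n).+1); last by lia.
      by rewrite -polyCM size_polyC leq_b1.
    by rewrite expr2; apply: (sM _ _ n.+1 n.+1) => //; lia.
  have := congr1 (fun q : {poly K} => q`_k.-1) dU.
  rewrite /= coef_derivE prednK // coef0 => h.
  have hu : (k%:R : K) \is a GRing.unit by rewrite unit_lt ?k0.
  by apply: (mulrI hu); rewrite h mulr0.
have p_gt0 : (0 < p)%N by rewrite p_eq.
have defU : U = (U`_0)%:P + U`_p *: 'X^p.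
  apply/polyP => k; rewrite coefD coefC coefZ coefXn.
  case: eqP => [->|/eqP k0]; first by rewrite ltn_eqF // mulr0 addr0.
  by case: eqP => [->|/eqP kp]; rewrite ?mulr1 ?add0r // mulr0 cU // lt0n.
have Ue t : U.[t] = U`_0 + U`_p * t ^+ p by rewrite {1}defU !hornerE.
have eE t : e.[t] = (-1) ^+ n.
  by rewrite /e -signr_odd -[RHS]signr_odd; case: odd; rewrite ?expr1 ?hornerN hornerC.
have PE t : (p%:R : {poly K}).[t] = p%:R by rewrite -polyC_natr hornerC.
have sE t : s.[t] = r.[- t] by rewrite horner_comp !hornerE.
have rN1 : p%:R * r.[-1] = p%:R * (-1) ^+ n * r.[1].
  by have := congr1 (fun q => q.[1]) Ps; rewrite /= !hornerM ?eE !PE sE.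
(* At t = 1 and t = -1 the factor 1 - t^2 vanishes, and p r(1)^2 = p 4^n = p. *)
have U1 : U.[1] = p%:R * (-1) ^+ n.
  rewrite /U /W !hornerE ?eE ?PE ctrp1 /=.
  by apply: (lincomb1 (c := (-1) ^+ n) mulp_pow4); ring.
have UN1 : U.[-1] = p%:R * (-1) ^+ n.
  rewrite -U1 /U /W !hornerE ?eE ?PE /=.
  have e2 : (-1) ^+ n * (-1) ^+ n = 1 :> K by rewrite -exprMn mulrNN mulr1 expr1n.
  apply: (lincomb2 (c1 := (-1) ^+ n * (r.[-1] + (-1) ^+ n * r.[1]))
    (c2 := p%:R * (-1) ^+ n * r.[1] ^+ 2) rN1 e2); ring.
have odd_p : (-1) ^+ p = -1 :> K by rewrite p_eq exprS exprM sqrrN !expr1n mulr1.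
(* As p is odd, the values at 1 and -1 are U_0 + U_p and U_0 - U_p; adding them removes U_p. *)
have U0 : U`_0 = p%:R * (-1) ^+ n.
  move: U1 UN1; rewrite !Ue expr1n odd_p => h1 h2; apply: (mulrI unit2).
  by apply: (lincomb2 (c1 := 1) (c2 := 1) h1 h2); ring.
have h0 : U.[0] = U`_0 by rewrite Ue expr0n gtn_eqF ?mulr0 ?addr0.
have ds0 : s^`().[0] = F1.
  by rewrite ns hornerN horner_comp hornerN hornerX oppr0 deriv_ctrp0 opprK.
move: h0; rewrite U0 /U /W !hornerE ?eE ?PE /= ds0 sE oppr0 deriv_ctrp0 ctrp0 => h.
by apply: (lincomb1 (c := 1) h); ring.
Qed.

(* [coef_ctrp_rec] loses its last term on the indices congruent to n mod 2 *)
Lemma coef_ctrp_same m b i : n = (2 * m + b)%N -> (b < 2)%N -> (i <= m)%N ->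
  r`_b * 4 ^+ i * (m ^_ i)%:R ^+ 2 = r`_(2 * i + b) * (2 * i + b)`!%:R.
Proof.
move=> hn hb; elim: i => [|i IH] hi.
  rewrite ffactn0 expr0 expr1n !mulr1 muln0 add0n.
  by case: b hb {hn} => [|[|]] // _; rewrite mulr1.
have {IH} := IH (ltnW hi).
have := coef_ctrp_rec K n (2 * i + b); rewrite p_eqE.
have hodd : odd (n + (2 * i + b).+1) by rewrite hn; lia.
have := mulp_coef_ctrp_opp hodd.
rewrite (_ : 2 * i.+1 + b = (2 * i + b).+2)%N; last by lia.
have -> : n%:R - (2 * i + b)%:R = 2 * (m%:R - i%:R) :> K by rewrite hn; ring.
rewrite ffactnSr natrM natrB; last by lia.
rewrite !factS; set k := (2 * i + b)%N => h1 h2 h3.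
apply: (lincomb3 (c1 := - k.+1%:R * k`!%:R) (c2 := - k`!%:R)
  (c3 := 4 * (m%:R - i%:R) ^+ 2) h1 h2 h3).
by rewrite !natrM exprS; ring.
Qed.

Lemma unit_fact k : (k < p)%N -> (k`!%:R : K) \is a GRing.unit.
Proof.
elim: k => [|k IH] hk; first exact: unitr1.
by rewrite factS natrM unitrM unit_lt //= IH // ltnW.
Qed.

(** At i = m, [coef_ctrp_same] leads from r(0) to the leading coefficient (-1)^n. *)
Lemma sqbinp1_even m : n = (2 * m)%N -> F * 2 ^+ n = 'C(n, m)%:R.
Proof.
move=> hn.
have := @coef_ctrp_same m 0%N m; rewrite !addn0 -hn => /(_ erefl isT (leqnn m)).
rewrite ffactnn -horner_coef0 ctrp0 lead_ctrp.
have hm : (m <= n)%N by lia.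
rewrite -[in n`!](bin_fact hm) (_ : n - m = m)%N; last by lia.
have -> : (-1) ^+ n = 1 :> K by rewrite hn exprM sqrrN !expr1n.
have -> : 2 ^+ n = 4 ^+ m :> K by rewrite hn exprM; congr (_ ^+ m); ring.
have hf : (m`!%:R ^+ 2 : K) \is a GRing.unit.
  by rewrite unitrX // unit_fact // p_eq; lia.
by move=> h; apply: (mulIr hf); apply: (lincomb1 (c := 1) h); rewrite !natrM; ring.
Qed.

(** The chain now starts from r_1 = -[F1]; the quotient (m+1)!/m! = m + 1 produces the factor p + 1
    = 4(m + 1). *)
Lemma deriv_sqbinp1_odd m : n = (2 * m + 1)%N ->
  2 * F1 * 2 ^+ n = (p%:R + 1) * 'C(n, m)%:R.
Proof.
move=> hn.
have := @coef_ctrp_same m 1%N m; rewrite -hn => /(_ erefl isT (leqnn m)).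
have -> : r`_1 = - F1.
  by rewrite -[RHS]deriv_ctrp0 horner_coef0 coef_derivE mul1r.
rewrite ffactnn lead_ctrp.
have hm : (m <= n)%N by lia.
rewrite -[in n`!](bin_fact hm) (_ : n - m = m.+1)%N; last by lia.
have -> : (-1) ^+ n = -1 :> K by rewrite hn exprD exprM sqrrN !expr1n mul1r.
have -> : 2 ^+ n = 2 * 4 ^+ m :> K.
  by rewrite hn exprD exprM mulrC; congr (_ * _ ^+ m); ring.
have hf : (m`!%:R ^+ 2 : K) \is a GRing.unit.
  by rewrite unitrX // unit_fact // p_eq; lia.
move=> h; apply: (mulIr hf); apply: (lincomb1 (c := - 4) h).
by rewrite p_eq hn factS !natrM; ring.
Qed.

(** Index 0 has the parity opposite to n, so [F] is itself a multiple of p. *)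
Lemma mulp_sqbinp1_odd m : n = (2 * m + 1)%N -> p%:R * F = 0 /\ F ^+ 2 = 0.
Proof.
move=> hn; have [|z hz] := @coef_ctrp_opp 0; first by rewrite hn; lia.
rewrite -ctrp0 horner_coef0 hz; split.
  by apply: (lincomb1 (c := z) psq0); ring.
by apply: (lincomb1 (c := z ^+ 2) psq0); ring.
Qed.

(** * Clausen's identity over Z/p^2 and the weighted sums *)

Lemma clausen : legp K n ^+ 2 = clausenp K n \Po ('X + 'X ^+ 2).
Proof.
apply/eqP; rewrite -subr_eq0; apply/eqP.
have sl : (size (legp K n) <= n.+1)%N by exact: size_poly.
have sc : (size (clausenp K n) <= n.+1)%N by exact: size_poly.
(* Both sides have degree at most 2n = p - 1, so the indices to be inverted are below p; the
   constant terms are both 1. *)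
apply: (@sqode_eq0 _ n (2 * n)%N).
- by move=> k hk; apply: unit_lt; rewrite p_eq ltnS.
- apply: leq_trans (size_polyD _ _) _; rewrite size_polyN geq_max; apply/andP; split.
    by rewrite expr2; apply: leq_trans (size_polyMleq _ _) _; move: (size _) sl => *; lia.
  apply: leq_trans (size_comp_poly_leq _ _) _; rewrite ltnS.
  rewrite mulnC; apply: leq_mul.
    rewrite -subn1 leq_subLR.
    by apply: leq_trans (size_polyD _ _) _; rewrite size_polyX size_polyXn.
  by rewrite -subn1 leq_subLR.
- rewrite coefB expr2 coef0M coef_legp !bin0 -horner_coef0 horner_comp.
  rewrite hornerD hornerX hornerXn expr0n add0r horner_coef0 coef_clausenp.
  by rewrite !bin0 mulr1 subrr.
by rewrite sqodeB sqode_legp sqode_clausenp subrr.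
Qed.

Definition clausen_sum j : K := \sum_(k < n.+1) k%:R ^+ j * (clausenp K n)`_k * 2 ^+ k.

(** Here 4n(n+1) = p^2 - 1 = -1, so 4(n(n+1) - k(k+1)) = -(2k+1)^2 and both sides have the same
    ratio of consecutive terms. *)
Lemma central_bin_cube k : (k <= n)%N ->
  (clausenp K n)`_k * 2 ^+ k * (-8) ^+ k = 'C(2 * k, k)%:R ^+ 3.
Proof.
rewrite -mulrA -exprMn (_ : 2 * -8 = -16); last by ring.
elim: k => [|k IH] hk; first by rewrite coef_clausenp muln0 !bin0 expr0 expr1n mulr1.
have {}IH := IH (ltnW hk).
have uk : (k.+1%:R ^+ 3 : K) \is a GRing.unit by rewrite unitrX // unit_lt // p_eq; lia.
apply: (mulrI uk).
have h2 : k.+1%:R * 'C(2 * k.+1, k.+1)%:R = 2 * (2 * k).+1%:R * 'C(2 * k, k)%:R :> K.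
  by rewrite -natrM central_binS !natrM.
have h3 : 4 * (n%:R * n.+1%:R) = - 1 :> K.
  by apply: (lincomb1 (c := 1) psq0); rewrite p_eq; ring.
rewrite -exprMn h2 mulrA coef_clausenpS exprS.
apply: (lincomb2 (c1 := 8 * (2 * k).+1%:R ^+ 3)
  (c2 := - 8 * (2 * k).+1%:R * (clausenp K n)`_k * (-16) ^+ k) IH h3).
by ring.
Qed.

Local Notation L1 := ((legp K n)^`().[1]).
Local Notation S := clausen_sum.

Lemma fourN : 4 * (n * n.+1)%:R = -1 :> K.
Proof. by apply: (lincomb1 (c := 1) psq0); rewrite p_eq; ring. Qed.

Lemma horner_sum_le (q : {poly K}) t : (size q <= n.+1)%N ->
  \sum_(k < n.+1) q`_k * t ^+ k = q.[t].
Proof. by move/horner_coef_wide => ->. Qed.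

Lemma size_Xderiv (q : {poly K}) m : (size q <= m)%N -> (size ('X * q^`())%R <= m)%N.
Proof.
by move/leq_sizeP => h; apply/leq_sizeP => j hj; rewrite coefX_deriv h // mulr0.
Qed.

(** Clausen's identity and its first two derivatives are evaluated at w = 1, where w + w^2 = 2 and 1
    + 2w = 3; Legendre's equation eliminates the second derivative of [legp]. *)
Lemma clausen_sum_horner :
  [/\ S 0 = F ^+ 2, 3 * S 1 = 4 * (F * L1)
    & 27 * S 2 = 24 * L1 ^+ 2 - 3 * F ^+ 2 - 16 * (F * L1)].
Proof.
pose c := clausenp K n.
have sc : (size c <= n.+1)%N by exact: size_poly.
have X1 : ('X + 'X ^+ 2 : {poly K}).[1] = 2 by rewrite hornerD hornerX hornerXn expr1n.
have L : (legp K n).[1] = F by exact: legp1.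
have e0 := clausen ; rewrite -/c in e0.
have c2 : c.[2] = F ^+ 2.
  by have := congr1 (fun q => q.[1]) e0; rewrite /= horner_comp X1 horner_exp L.
have e1 := congr1 (fun q : {poly K} => q^`()) e0.
rewrite /= expr2 derivM deriv_comp derivXX in e1.
have c1 : 3 * c^`().[2] = 2 * (F * L1).
  have := congr1 (fun q => q.[1]) e1.
  rewrite /= !(hornerM, hornerD) horner_comp X1 L hornerX -polyC1 hornerC => h.
  by apply: (lincomb1 (c := -1) h); ring.
have e2 := congr1 (fun q : {poly K} => q^`()) e1.
have d1 : (1 : {poly K})^`() = 0 by apply: derivC.
rewrite /= derivD !derivM deriv_comp derivXX !(derivD, derivM, derivX) d1 in e2.
have c3 : 9 * c^`()^`().[2] + 2 * c^`().[2]
     = 2 * L1 ^+ 2 + 2 * (F * (legp K n)^`()^`().[1]).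
  have := congr1 (fun q => q.[1]) e2.
  rewrite /= !(hornerM, hornerD) !horner_comp X1 L hornerX -polyC1 !hornerC => h.
  by apply: (lincomb1 (c := -1) h); ring.
have e3 := congr1 (fun q => q.[1]) (legp_ode K n).
rewrite /= !(hornerM, hornerD, hornerX, hornerXn) L -polyC_natr !hornerC ?expr1n in e3.
have s0 : S 0 = F ^+ 2.
  rewrite -c2 -horner_sum_le //; apply: eq_bigr => k _; by rewrite mul1r.
have s1 : S 1 = 2 * c^`().[2].
  have -> : 2 * c^`().[2] = ('X * c^`()).[2] by rewrite hornerM hornerX.
  rewrite -horner_sum_le ?size_Xderiv //; apply: eq_bigr => k _.
  by rewrite coefX_deriv expr1.
have s2 : S 2 = 4 * c^`()^`().[2] + 2 * c^`().[2].
  have -> : 4 * c^`()^`().[2] + 2 * c^`().[2] = ('X * ('X * c^`())^`()).[2].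
    by rewrite derivM derivX !(hornerM, hornerD) hornerX -polyC1 hornerC; ring.
  rewrite -horner_sum_le ?size_Xderiv //; apply: eq_bigr => k _.
  by rewrite !coefX_deriv expr2 !mulrA.
split=> //.
  by rewrite s1; apply: (lincomb1 (c := 2) c1); ring.
rewrite s2.
apply: (lincomb4 (c1 := 12) (c2 := 10) (c3 := 12 * F) (c4 := 3 * F ^+ 2) c3 c1 e3 fourN).
ring.
Qed.

(** With c_k the coefficients of [clausenp] and u_k = k^3 c_k 2^k, the difference u_(k+1) - u_k is
    -((2k+1)^3 + k^3) c_k 2^k, and (2k+1)^3 + k^3 = 9k^3 + 12k^2 + 6k + 1. *)
Lemma clausen_sum3 : 9 * S 3 + 12 * S 2 + 6 * S 1 + S 0 = 0.
Proof.
pose u k : K := k%:R ^+ 3 * (clausenp K n)`_k * 2 ^+ k.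
have tel : \sum_(0 <= k < n.+1) (u k.+1 - u k) = 0.
  by rewrite telescope_sumr // /u coef_clausenp bin_small // expr0n /=; ring.
transitivity (- \sum_(0 <= k < n.+1) (u k.+1 - u k)); last by rewrite tel oppr0.
rewrite /clausen_sum big_mkord -sumrN !mulr_sumr -!big_split /=.
apply: eq_bigr => k _; rewrite /u (exprS 2).
apply: (lincomb2 (c1 := 2 * 2 ^+ k) (c2 := (2 * k).+1%:R * (clausenp K n)`_k * 2 ^+ k)
  (coef_clausenpS K n k) fourN); ring.
Qed.

Lemma leg_deriv : 4 * L1 = 2 * (sqbinp K n)^`().[1] + 2 * n%:R * F.
Proof. by apply: (lincomb1 (c := 2) (deriv_legp1 K n)); ring. Qed.

Lemma clausen_sums_even m (xx : K) : n = (2 * m)%N ->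
  F ^+ 2 = 4 * xx - 2 * p%:R ->
  27 * S 2 = 10 * xx - 12 * p%:R /\ 81 * S 3 = - 4 * xx + 12 * p%:R.
Proof.
move=> hn hx; have [s0 s1 s2] := clausen_sum_horner; have s3 := clausen_sum3.
have w := wronskian .
have e1 : (-1) ^+ n = 1 :> K by rewrite hn exprM sqrrN !expr1n.
rewrite e1 in w.
have nE := n_eqE.
have hFL : 4 * (F * L1) = p%:R - F ^+ 2.
  apply: (lincomb3 (c1 := F) (c2 := 1) (c3 := F ^+ 2) leg_deriv w nE); ring.
(* [F] 2^n = C(n,m) divides n!, hence is a unit; [L1] squared can then be found from the square of
   [F * L1]. *)
have uF : F ^+ 2 \is a GRing.unit.
  have : F * 2 ^+ n \is a GRing.unit.
    rewrite (sqbinp1_even hn); have hm : (m <= n)%N by lia.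
    have : (n`!%:R : K) \is a GRing.unit by rewrite unit_fact // p_eq; lia.
    by rewrite -(bin_fact hm) natrM unitrM => /andP[].
  by rewrite unitrM => /andP[/unitrX ->].
have hL : 16 * L1 ^+ 2 = F ^+ 2 - 2 * p%:R.
  apply: (mulIr uF).
  apply: (lincomb2 (c1 := 4 * (F * L1) + p%:R - F ^+ 2) (c2 := 1) hFL psq0); ring.
have h2 : (2 : K) \is a GRing.unit by exact: unit2.
split; apply: (mulIr h2).
  by apply: (lincomb4 (c1 := 2) (c2 := 3) (c3 := -8) (c4 := 5) s2 hL hFL hx); ring.
have e81 : 81 * S 3 = - 96 * L1 ^+ 2 + 3 * F ^+ 2 - 8 * (F * L1).
  by apply: (lincomb4 (c1 := 9) (c2 := -4) (c3 := -18) (c4 := -9) s3 s2 s1 s0); ring.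
by apply: (lincomb4 (c1 := 2) (c2 := -12) (c3 := -4) (c4 := -2) e81 hL hFL hx); ring.
Qed.

Lemma fermat_expr a : ~~ (p %| a)%N -> exists z, a%:R ^+ (p - 1) = 1 + p%:R * z :> K.
Proof.
move=> ha; have p0 := prime_gt0 p_prime.
have h : a ^ (p - 1) = 1 %[mod p].
  rewrite subn1 -(totient_prime p_prime); apply: Euler_exp_totient.
  by rewrite coprime_sym prime_coprime.
exists ((a ^ (p - 1)) %/ p)%N%:R.
rewrite -natrX {1}(divn_eq (a ^ (p - 1)) p) h modn_small ?prime_gt1 //; ring.
Qed.

Lemma clausen_sums_odd m : n = (2 * m + 1)%N ->
  let R1 := (2 * p%:R + 2 - 2 ^+ (p - 1)) * 'C(n, m)%:R ^+ 2 in
  54 * S 2 = 14 * p%:R + 3 * R1 /\ 81 * S 3 = - 10 * p%:R - 6 * R1.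
Proof.
move=> hn R1; have [s0 s1 s2] := clausen_sum_horner; have s3 := clausen_sum3.
have w := wronskian.
have e1 : (-1) ^+ n = -1 :> K by rewrite hn exprD exprM sqrrN !expr1n mul1r.
have [pF F2] := mulp_sqbinp1_odd hn.
have T := deriv_sqbinp1_odd hn.
set T1 := (sqbinp K n)^`().[1] in w T.
have w' : 2 * F * T1 = - p%:R.
  by rewrite w e1 F2; ring.
have ld := leg_deriv; rewrite -/T1 in ld.
have hFL : 4 * (F * L1) = - p%:R.
  by apply: (lincomb3 (c1 := F) (c2 := 1) (c3 := 2 * n%:R) ld w' F2); ring.
have hL : 16 * L1 ^+ 2 = 4 * T1 ^+ 2 + 2 * p%:R.
  apply: (lincomb5 (c1 := 4 * L1 + (2 * T1 + 2 * n%:R * F)) (c2 := 4 * n%:R)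
    (c3 := 4 * n%:R ^+ 2) (c4 := - 2 * p%:R) (c5 := - 2) ld w' F2 n_eqE psq0).
  by ring.
(* Squared, [T] reads 4 [T1]^2 2^(p-1) = (1+p)^2 C(n,m)^2. With 2^(p-1) = 1 + pz, the quotient
   (1+2p)(1-pz) is 1 + 2p - pz = 2p + 2 - 2^(p-1), the factor in [R1]. *)
have hR : 4 * T1 ^+ 2 = R1.
  have [|z hz] := @fermat_expr 2; first by rewrite gtnNdvd // p_eq; lia.
  have hQ : 2 ^+ (p - 1) = 2 ^+ n * 2 ^+ n :> K.
    by rewrite -exprD; congr (_ ^+ _); rewrite p_eq; lia.
  have uQ : (2 : K) ^+ (p - 1) \is a GRing.unit by rewrite unitrX // unit2.
  apply: (mulIr uQ); rewrite {1}hQ /R1 hz.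
  apply: (lincomb2 (c1 := 2 * T1 * 2 ^+ n + (p%:R + 1) * 'C(n, m)%:R)
    (c2 := (1 - 2 * z + z ^+ 2) * 'C(n, m)%:R ^+ 2) T psq0).
  by ring.
split.
  by apply: (lincomb5 (c1 := 2) (c2 := 3) (c3 := -6) (c4 := -8) (c5 := 3)
    s2 hL F2 hFL hR); ring.
have e81 : 81 * S 3 = - 96 * L1 ^+ 2 + 3 * F ^+ 2 - 8 * (F * L1).
  by apply: (lincomb4 (c1 := 9) (c2 := -4) (c3 := -18) (c4 := -9) s3 s2 s1 s0); ring.
by apply: (lincomb5 (c1 := 1) (c2 := -6) (c3 := 3) (c4 := -2) (c5 := -6)
  e81 hL F2 hFL hR); ring.
Qed.

(** * The Fermat quotient of 2 and two binomial coefficients modulo p^2 *)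

Lemma mulp_bin k : (k < p)%N -> p%:R * 'C(p - 1, k)%:R = p%:R * (-1) ^+ k :> K.
Proof.
elim: k => [|k IH] hk; first by rewrite bin0 expr0.
have uk : (k.+1%:R : K) \is a GRing.unit by apply: unit_lt.
have h := binS_mul K (p - 1) k.
have hp1 : (p - 1)%N%:R = p%:R - 1 :> K by rewrite natrB // prime_gt0.
rewrite hp1 in h; apply: (mulIr uk).
apply: (lincomb3 (c1 := p%:R) (c2 := p%:R - k.+1%:R) (c3 := (-1) ^+ k)
  h (IH (ltnW hk)) psq0).
by rewrite exprS; ring.
Qed.

(** Expand 2^p = (1 + 1)^p and use C(p,k+1) = p C(p-1,k)/(k+1) with C(p-1,k) = (-1)^k modulo p. *)
Lemma fermat_quotient_alt :
  2 * 2 ^+ (p - 1) = 2 + p%:R * \sum_(k < 2 * n) (-1) ^+ k / k.+1%:R :> K.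
Proof.
have p0 := prime_gt0 p_prime.
rewrite -exprS (_ : (p - 1).+1 = p); last by lia.
rewrite -[2 in X in X = _]/(1 + 1) exprDn p_eq big_ord_recl big_ord_recr /= -p_eq.
rewrite !expr1n !mulr1 (_ : bump 0 (2 * n) = p); last by rewrite p_eq.
rewrite bin0 binn mulr_sumr.
rewrite (eq_bigr (fun k : 'I_(2 * n) => p%:R * ((-1) ^+ k / k.+1%:R))) => [|k _].
  by ring.
have hk := ltn_ord k.
have uk : (k.+1%:R : K) \is a GRing.unit by apply: unit_lt; rewrite p_eq ltnS.
rewrite !expr1n mulr1 mulrA -mulp_bin; last by rewrite p_eq; lia.
apply: (canRL (mulrK uk)); rewrite -natrM -natrM.
by rewrite /bump /= add1n mulnC -mul_bin_diag subn1.
Qed.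

(** The reflection k -> 2n - 1 - k changes the sign (-1)^k and replaces the denominator b by p - b,
    which is -b modulo p; so both halves agree. *)
Lemma alt_sum_double :
  p%:R * \sum_(k < 2 * n) (-1) ^+ k / k.+1%:R
  = 2 * p%:R * \sum_(k < n) (-1) ^+ k / k.+1%:R :> K.
Proof.
rewrite mul2n -addnn big_split_ord /= [X in _ * (_ + X)](reindex_inj rev_ord_inj) /=.
rewrite mulrDr !mulr_sumr -big_split /=; apply: eq_bigr => k _.
have hk := ltn_ord k.
have u1 : (k.+1%:R : K) \is a GRing.unit by apply: unit_lt; rewrite p_eq; lia.
have u2 : ((n + (n - k.+1)).+1%:R : K) \is a GRing.unit.
  by apply: unit_lt; rewrite p_eq; lia.
have -> : (-1) ^+ (n + (n - k.+1)) = - (-1) ^+ k :> K.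
  rewrite -[LHS]signr_odd -[(-1) ^+ k in RHS]signr_odd.
  have -> : odd (n + (n - k.+1)) = ~~ odd k by lia.
  by case: odd; rewrite ?opprK.
have e : (n + (n - k.+1)).+1%:R = p%:R - k.+1%:R :> K.
  rewrite -natrB; last by rewrite p_eq; lia.
  by congr _%:R; rewrite p_eq; lia.
set a := (n + _).+1%:R in u2 e *; set b := k.+1%:R in u1 e *.
apply: (mulIr u1); apply: (mulIr u2).
have ha := mulVr u2; have hb := mulVr u1.
transitivity (p%:R * (-1) ^+ k * (b^-1 * b) * a - p%:R * (-1) ^+ k * (a^-1 * a) * b).
  by ring.
transitivity (2 * p%:R * (-1) ^+ k * (b^-1 * b) * a); last by ring.
rewrite ha hb e; apply: (lincomb1 (c := - (-1) ^+ k) psq0); ring.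
Qed.

(** Catalan's identity. From m to m + 1 the right side loses 1/(m+1) = 2/(2m+2) and gains 1/(2m+1) +
    1/(2m+2). *)
Lemma catalan_alt_sum m : (2 * m < p)%N ->
  \sum_(k < 2 * m) (-1) ^+ k / k.+1%:R = \sum_(i < m) (m + i).+1%:R^-1 :> K.
Proof.
elim: m => [|m IH] hm; first by rewrite muln0 !big_ord0.
rewrite (_ : 2 * m.+1 = (2 * m).+2)%N; last by lia.
pose f i : K := i.+1%:R^-1.
have h : f m + \sum_(i < m.+1) f (m.+1 + i)%N
    = \sum_(i < m) f (m + i)%N + f (2 * m)%N + f (2 * m).+1.
  transitivity (\sum_(i < m.+2) f (m + i)%N).
    rewrite [RHS]big_ord_recl addn0; congr (_ + _); apply: eq_bigr => i _.
    by rewrite addSnnS.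
  by rewrite !big_ord_recr /= addnS addnn -mul2n.
have e : f m = 2 * f (2 * m).+1.
  have u1 : (m.+1%:R : K) \is a GRing.unit by apply: unit_lt; lia.
  have u2 : (2 : K) \is a GRing.unit by exact: unit2.
  rewrite /f (_ : (2 * m).+2 = 2 * m.+1)%N; last by lia.
  by rewrite natrM invrM // mulrCA mulrV // mulr1.
transitivity (\sum_(i < m) f (m + i)%N + f (2 * m)%N - f (2 * m).+1).
  rewrite !big_ord_recr /= IH; last by lia.
  by rewrite exprS exprM sqrrN !expr1n /f; ring.
by apply: (lincomb2 (c1 := -1) (c2 := 1) h e); rewrite /f; ring.
Qed.

Lemma fermat_quotient_harmonic m : n = (2 * m)%N ->
  2 ^+ (p - 1) = 1 + p%:R * \sum_(i < m) (m + i).+1%:R^-1 :> K.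
Proof.
move=> hn; apply: (mulrI unit2); rewrite fermat_quotient_alt alt_sum_double.
rewrite [in X in _ * X]hn catalan_alt_sum; last by rewrite p_eq; lia.
by ring.
Qed.

(** First-order expansion in p, exact because p^2 = 0. *)
Lemma prod_shift a b : (a + b < p)%N ->
  \prod_(i < b) (p%:R + (a + i).+1%:R)
  = (1 + p%:R * \sum_(i < b) (a + i).+1%:R^-1) * \prod_(i < b) (a + i).+1%:R :> K.
Proof.
elim: b => [|b IH] hb; first by rewrite !big_ord0 mulr0 addr0 mulr1.
rewrite !big_ord_recr /= IH; last by lia.
have u : ((a + b).+1%:R : K) \is a GRing.unit by apply: unit_lt; lia.
set s := \sum_(i < b) _; set r := \prod_(i < b) _; set c := (a + b).+1%:R in u *.
apply: (lincomb2 (c1 := r * s) (c2 := - r * p%:R) psq0 (mulVr u)).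
by ring.
Qed.

Lemma fact_rising a b : (a + b)`! = (a`! * \prod_(i < b) (a + i).+1)%N.
Proof.
elim: b => [|b IH]; first by rewrite addn0 big_ord0 muln1.
by rewrite addnS factS IH big_ord_recr /=; ring.
Qed.

Lemma bin_rising a b : ('C(a + b, b) * b`! = \prod_(i < b) (a + i).+1)%N.
Proof.
have h := bin_fact (leq_addl a b); rewrite addnK fact_rising in h.
by apply/eqP; rewrite -(eqn_pmul2l (fact_gt0 a)) -h; apply/eqP; ring.
Qed.

(** With p = 4m + 1 the numerator factors of C(6m,m) are p + m + i for i < m. Shifting i by one
    gives the product [H] of [prod_shift], whose harmonic sum is the Fermat quotient of 2. *)
Lemma bin_6m_m m : n = (2 * m)%N ->
  2 * 'C(6 * m, m)%:R = 2 ^+ (p - 1) * (1 - 2 * p%:R) * 'C(2 * m, m)%:R :> K.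
Proof.
move=> hn.
have um : (m`!%:R : K) \is a GRing.unit by apply: unit_fact; rewrite p_eq; lia.
have natr_bin a : 'C(a + m, m)%:R * m`!%:R = \prod_(i < m) (a + i).+1%:R :> K.
  by rewrite -natrM bin_rising natr_prod.
apply: (mulIr um); rewrite -[LHS]mulrA -[RHS]mulrA.
rewrite (_ : 6 * m = 5 * m + m)%N; last by lia.
rewrite [in X in _ = X](_ : 2 * m = m + m)%N; last by lia.
rewrite !natr_bin.
pose G := \prod_(i < m) (p%:R + (m + i)%N%:R) : K.
have -> : \prod_(i < m) (5 * m + i).+1%:R = G.
  apply: eq_bigr => i _; rewrite -natrD; congr _%:R; rewrite p_eq hn; lia.
pose H := \prod_(i < m) (p%:R + (m + i).+1%:R) : K.
have hH : H = 2 ^+ (p - 1) * \prod_(i < m) (m + i).+1%:R.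
  by rewrite (fermat_quotient_harmonic hn) -prod_shift // p_eq hn; lia.
have hGH : G * (p%:R + (2 * m)%N%:R) = (p%:R + m%:R) * H.
  transitivity (\prod_(i < m.+1) (p%:R + (m + i)%N%:R) : K).
    by rewrite big_ord_recr /= addnn -mul2n.
  rewrite [LHS]big_ord_recl addn0; congr (_ * _); apply: eq_bigr => i _.
  by rewrite lift0 addnS.
have nE := n_eqE; rewrite hn in nE.
have hm : 4 * m%:R = p%:R - 1 :> K by rewrite -nE; ring.
rewrite -[RHS]mulrA [RHS]mulrCA -hH.
(* (p+m)/(p+2m) = (1-5p)/(2(1-3p)) = (1-2p)/2, where 1 + 3p is the inverse of 1 - 3p. *)
apply: (lincomb3 (c1 := - (1 + 3 * p%:R) * 4) (c2 := (1 + 3 * p%:R) * (2 * G - H))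
   (c3 := 18 * G - 15 * H) hGH hm psq0).
by rewrite natrM; ring.
Qed.

Lemma wilson_mulp : p%:R * (p - 1)`!%:R = - p%:R :> K.
Proof.
have p1 := prime_gt1 p_prime; have := Wilson p1; rewrite p_prime -subn1 => /esym h.
have := @mulp_mod (p - 1)`!.+1 0; rewrite mod0n mulr0 => /(_ (eqP h)) e.
by apply: (lincomb1 (c := 1) e); ring.
Qed.

(** As 6m = p + 2m - 1, (6m)! contains the factor p once, and the other factors matter only modulo
    p, where Wilson's theorem applies. *)
Lemma bin_6m_3m m : n = (2 * m)%N ->
  'C(6 * m, 3 * m)%:R * 'C(2 * m, m)%:R = - 2 * p%:R :> K.
Proof.
move=> hn; have W := wilson_mulp.
have m0 : (0 < m)%N by lia.
have hp1 : (p - 1 = 4 * m)%N by rewrite p_eq hn; lia.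
rewrite hp1 in W.
have bf a b : ('C(a + b, b) * (b`! * a`!) = (a + b)`!)%N.
  by have := bin_fact (leq_addl a b); rewrite addnK.
have e6 : 'C(6 * m, 3 * m)%:R * (3 * m)`!%:R ^+ 2 = - p%:R * (2 * m).-1`!%:R :> K.
  have -> : 'C(6 * m, 3 * m)%:R * (3 * m)`!%:R ^+ 2 = (p + (2 * m).-1)`!%:R :> K.
    rewrite (_ : p + (2 * m).-1 = 3 * m + 3 * m)%N; last by rewrite p_eq hn; lia.
    by rewrite -bf (_ : 6 * m = 3 * m + 3 * m)%N ?natrM ?expr2 //; lia.
  rewrite fact_rising natrM natr_prod.
  have hpf : p`!%:R = - p%:R :> K.
    rewrite -W -hp1 -natrM -[in LHS](prednK (prime_gt0 p_prime)) factS.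
    by rewrite prednK ?prime_gt0 // subn1.
  rewrite hpf; elim: (2 * m).-1 => [|k IH]; first by rewrite big_ord0.
  rewrite big_ord_recr /= mulrA IH factS !natrM.
  by apply: (lincomb1 (c := - k`!%:R) psq0); rewrite -addnS natrD; ring.
have e4 : p%:R * (2 * m)`!%:R ^+ 2 = - p%:R :> K.
  have e : (2 * m + 2 * m = p - 1)%N by lia.
  have h : p%:R * 'C(2 * m + 2 * m, 2 * m)%:R = p%:R :> K.
    rewrite e mulp_bin; last by rewrite p_eq; lia.
    by rewrite exprM sqrrN !expr1n mulr1.
  rewrite -W -hp1 -e -bf !natrM.
  by apply: (lincomb1 (c := - (2 * m)`!%:R ^+ 2) h); ring.
have e3 : p%:R * (m`!%:R * (3 * m)`!%:R) ^+ 2 = p%:R :> K.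
  have h : p%:R * (-1) ^+ m * (m`!%:R * (3 * m)`!%:R) = - p%:R :> K.
    rewrite -mulp_bin; last by rewrite p_eq; lia.
    by rewrite -W hp1 (_ : 4 * m = 3 * m + m)%N; [rewrite -bf !natrM; ring|lia].
  have s2 : (-1) ^+ m * (-1) ^+ m = 1 :> K by rewrite -exprMn mulrNN mulr1 expr1n.
  apply: (lincomb2 (c1 := (-1) ^+ m * (m`!%:R * (3 * m)`!%:R) - 1)
    (c2 := - p%:R * (m`!%:R * (3 * m)`!%:R) ^+ 2) h s2).
  by ring.
have e2 : 'C(2 * m, m)%:R * m`!%:R ^+ 2 = (2 * m)`!%:R :> K.
  by rewrite (_ : 2 * m = m + m)%N -?bf ?natrM; [ring|lia].
have e1 : (2 * m)`!%:R = (2 * m)%N%:R * (2 * m).-1`!%:R :> K.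
  have e0 : (2 * m)%N = (2 * m).-1.+1 by lia.
  by rewrite -natrM; congr _%:R; rewrite {1}e0 factS -e0.
have hm : 2 * (2 * m)%N%:R = p%:R - 1 :> K by rewrite -n_eqE hn.
have U : ((3 * m)`!%:R ^+ 2 * m`!%:R ^+ 2 * (2 * m)%N%:R : K) \is a GRing.unit.
  have u1 : ((3 * m)`!%:R : K) \is a GRing.unit by apply: unit_fact; rewrite p_eq; lia.
  have u2 : (m`!%:R : K) \is a GRing.unit by apply: unit_fact; rewrite p_eq; lia.
  have u3 : ((2 * m)%N%:R : K) \is a GRing.unit by apply: unit_lt; rewrite p_eq; lia.
  by rewrite unitrM u3 andbT unitrM !unitrX.
apply: (mulIr U).
move: e6 e4 e3 e2 e1 hm.
set C := 'C(6 * m, _)%:R; set B := 'C(2 * m, _)%:R; set x := (3 * m)`!%:R.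
set y := (2 * m).-1`!%:R; set z := (2 * m)`!%:R; set w := m`!%:R; set t := (2 * m)%N%:R.
move=> e6 e4 e3 e2 e1 hm.
have -> : C * B * (x ^+ 2 * w ^+ 2 * t) = - p%:R * z ^+ 2.
  by apply: (lincomb3 (c1 := B * w ^+ 2 * t) (c2 := - p%:R * y * t) (c3 := p%:R * z)
    e6 e2 e1); ring.
apply: (lincomb4 (c1 := -1) (c2 := 2 * t) (c3 := p%:R) (c4 := 1) e4 e3 hm psq0).
by ring.
Qed.

(** * Teichmueller representatives and the quadratic character modulo p^2 *)

Let card_FpE : #|'F_p| = (2 * n).+1. Proof. by rewrite card_Fp. Qed.
Local Notation qch := (@qchar 'F_p n).

(* [y] reduces to [x] modulo [p] *)
Definition lifts (y : K) (x : 'F_p) :=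
  exists a z, y = a%:R + p%:R * z /\ x = a%:R.

Lemma Fp_eq0 a : a%:R = 0 :> 'F_p -> (p %| a)%N.
Proof. by move=> h; rewrite (dvdn_pcharf (pchar_Fp p_prime)) h. Qed.

Lemma lifts_nat a : lifts a%:R a%:R.
Proof. by exists a, 0; rewrite mulr0 addr0. Qed.

Lemma liftsD y1 y2 x1 x2 : lifts y1 x1 -> lifts y2 x2 -> lifts (y1 + y2) (x1 + x2).
Proof.
move=> [a [z [-> ->]]] [b [w [-> ->]]]; exists (a + b)%N, (z + w).
by rewrite !natrD; split=> //; ring.
Qed.

Lemma liftsM y1 y2 x1 x2 : lifts y1 x1 -> lifts y2 x2 -> lifts (y1 * y2) (x1 * x2).
Proof.
move=> [a [z [-> ->]]] [b [w [-> ->]]].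
exists (a * b)%N, (a%:R * w + b%:R * z); rewrite !natrM; split=> //.
by apply: (lincomb1 (c := z * w) psq0); ring.
Qed.

Lemma liftsX y x k : lifts y x -> lifts (y ^+ k) (x ^+ k).
Proof.
move=> h; elim: k => [|k IH]; first exact: (lifts_nat 1).
by rewrite !exprS; apply: liftsM.
Qed.

Lemma liftsN1 : lifts (-1) (-1).
Proof.
have p0 := prime_gt0 p_prime.
exists (p - 1)%N, (-1); rewrite !natrB //; split; first by ring.
by rewrite (pchar_Fp_0 p_prime) sub0r.
Qed.

Lemma lifts0 y : lifts y 0 -> exists z, y = p%:R * z.
Proof.
move=> [a [z [-> /esym /Fp_eq0 /dvdnP[c ->]]]]; exists (c%:R + z).
by rewrite natrM; ring.
Qed.

Lemma lifts_uniq y1 y2 x : lifts y1 x -> lifts y2 x -> exists z, y1 = y2 + p%:R * z.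
Proof.
move=> h1 h2; have := liftsD h1 (liftsM liftsN1 h2).
rewrite !mulN1r subrr => /lifts0[z hz]; exists z.
by rewrite -hz; ring.
Qed.

Lemma lifts_unit y x : lifts y x -> x != 0 -> y \is a GRing.unit.
Proof.
move=> [a [z [-> ->]]] a0.
have ua : (a%:R : K) \is a GRing.unit.
  by apply: unit_nat; rewrite (dvdn_pcharf (pchar_Fp p_prime)).
have : (a%:R + p%:R * z) * (a%:R - p%:R * z) \is a GRing.unit.
  suff -> : (a%:R + p%:R * z) * (a%:R - p%:R * z) = a%:R ^+ 2 by rewrite unitrX.
  by apply: (lincomb1 (c := - z ^+ 2) psq0); ring.
by rewrite unitrM => /andP[].
Qed.

Lemma expr_lift (y z : K) k : (y + p%:R * z) ^+ k = y ^+ k + k%:R * y ^+ k.-1 * p%:R * z.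
Proof.
elim: k => [|k IH]; first by rewrite !expr0; ring.
rewrite exprS IH; case: k {IH} => [|k] /=; first by rewrite !expr0 !expr1; ring.
apply: (lincomb1 (c := k.+1%:R * y ^+ k * z ^+ 2) psq0).
by rewrite !exprS; ring.
Qed.

Lemma expr_lift_p (y z : K) : (y + p%:R * z) ^+ p = y ^+ p.
Proof.
rewrite expr_lift.
by apply: (lincomb1 (c := y ^+ p.-1 * z) psq0); ring.
Qed.

Lemma lifts_half y x : lifts y x -> exists z, y ^+ n = (qch x)%:~R + p%:R * z.
Proof.
move=> h; have hn := liftsX n h; rewrite /qchar.
case: eqP hn => [->|/eqP x0].
  by rewrite expr0n gtn_eqF 1?ltnW // => /lifts0[z ->]; exists z; rewrite add0r.
have [->|->] := expf_half card_FpE x0.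
  rewrite eqxx => hn; apply: (lifts_uniq hn); exact: (lifts_nat 1).
rewrite (negbTE (neg1_neq1 card_FpE)) => hn; apply: (lifts_uniq hn).
rewrite mulrN1z; exact: liftsN1.
Qed.

(* One Newton step [u |-> u (3 - u^2) / 2] towards the square roots of 1 turns
   [y^n], which is the quadratic character modulo [p], into its value modulo [p^2] *)
Lemma qchar_lift y x : lifts y x -> 3 * y ^+ n - y ^+ (3 * n) = 2 * (qch x)%:~R.
Proof.
move=> h; have [x0|x0] := eqVneq x 0.
  have [z ->] : exists z, y = p%:R * z by apply: lifts0; rewrite -x0.
  have e k : (1 < k)%N -> (p%:R * z) ^+ k = 0 :> K.
    by case: k => [|[|k]] // _; rewrite exprMn 2!exprS mulrA -expr2 psq0 !mul0r.
  by rewrite !e //; [rewrite x0 qchar0; ring|lia].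
have [z hz] := lifts_half h.
have s2 : (qch x)%:~R ^+ 2 = 1 :> K by rewrite -rmorphXn /= (qchar_sqr n x0).
rewrite mulnC exprM hz; set s := (qch x)%:~R in s2 *.
apply: (lincomb2 (c1 := - (3 * s * z ^+ 2 + p%:R * z ^+ 3)) (c2 := - s - 3 * p%:R * z)
  psq0 s2).
by ring.
Qed.

(** The Teichmueller representative modulo p^2: the p-th power of any lift, by [teich_lift]. *)
Definition teich (x : 'F_p) : K := (val x)%:R ^+ p.

Lemma val_Fp_natr (x : 'F_p) : (val x)%:R = x.
Proof. exact: natr_Zp. Qed.

Lemma teich_lift y x : lifts y x -> y ^+ p = teich x.
Proof.
move=> h; have := lifts_nat (val x); rewrite val_Fp_natr => h'.
by have [z ->] := lifts_uniq h h'; rewrite expr_lift_p.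
Qed.

Lemma lifts_val x : lifts (val x)%:R x.
Proof. by have := lifts_nat (val x); rewrite val_Fp_natr. Qed.

Lemma lifts_teich x : lifts (teich x) x.
Proof.
have := liftsX p (lifts_val x); rewrite -/(teich x).
have -> // : x ^+ p = x.
by have := expf_card x; rewrite card_Fp.
Qed.

Lemma teichM x y : teich (x * y) = teich x * teich y.
Proof. by rewrite -(teich_lift (liftsM (lifts_val x) (lifts_val y))) exprMn. Qed.

Lemma teich0 : teich 0 = 0.
Proof. by rewrite /teich /= expr0n gtn_eqF // prime_gt0. Qed.

Lemma teich_half x : teich x ^+ n = (qch x)%:~R.
Proof.
have [z hz] := lifts_half (lifts_val x).
rewrite /teich -exprM mulnC exprM hz expr_lift_p /qchar.
case: eqP => _; first by rewrite expr0n gtn_eqF // prime_gt0.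
case: ifP => _; first by rewrite expr1n.
by rewrite mulrN1z -signr_odd p_eq /= mul2n odd_double.
Qed.

(** If p - 1 divides e, every nonzero x contributes 1. Otherwise multiplying x by a primitive g
    scales the sum by [teich g ^+ e], and [teich g ^+ e - 1] is a unit because g^e differs from 1 in
    F_p. *)
Lemma sum_teich e : (0 < e)%N ->
  \sum_x teich x ^+ e = if (2 * n %| e)%N then p%:R - 1 else 0.
Proof.
move=> e0.
have t0 : teich 0 ^+ e = 0 by rewrite teich0 expr0n gtn_eqF.
rewrite (bigD1 0) //= t0 add0r; case: ifP => he.
  have t1 x : x != 0 -> teich x ^+ e = 1.
    move=> x0; have [c ->] := dvdnP he; rewrite mulnC exprM (mulnC 2) exprM teich_half.
    by rewrite -rmorphXn /= (qchar_sqr n x0) expr1n.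
  rewrite (eq_bigr _ t1) sumr_const.
  have := cardC (pred1 (0 : 'F_p)); rewrite card1 card_FpE add1n => -[h].
  rewrite (_ : #|_| = 2 * n)%N; last by rewrite -h; apply: eq_card.
  by rewrite natrM n_eqE.
have [g hg] := primitive_exists card_FpE.
have g1 : g ^+ e != 1 by rewrite -(prim_order_dvd hg) he.
have g0 : g != 0.
  apply/eqP => h; have := prim_expr_order hg.
  by rewrite h expr0n gtn_eqF ?muln_gt0 ?(ltnW n_gt1) // => /eqP; rewrite eq_sym oner_eq0.
have U : teich g ^+ e - 1 \is a GRing.unit.
  by apply: (lifts_unit (liftsD (liftsX e (lifts_teich g)) liftsN1)); rewrite subr_eq0.
have : (teich g ^+ e - 1) * \sum_x teich x ^+ e = 0.
  rewrite mulrBl mul1r {2}(reindex_inj (mulfI g0)) /= mulr_sumr -sumrB big1 // => x _.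
  by rewrite teichM exprMn subrr.
rewrite (bigD1 0) //= t0 add0r => h.
by apply: (mulrI U); rewrite h mulr0.
Qed.

Definition teich_sum N : K := \sum_x teich x ^+ n * (teich x ^+ 2 - 1) ^+ N.

Lemma teich_sumE N : teich_sum N = \sum_(i < N.+1)
  (-1) ^+ i * 'C(N, i)%:R * (if (2 * n %| n + 2 * (N - i))%N then p%:R - 1 else 0).
Proof.
rewrite /teich_sum.
transitivity (\sum_x \sum_(i < N.+1)
  (-1) ^+ i * 'C(N, i)%:R * teich x ^+ (n + 2 * (N - i))).
  apply: eq_bigr => x _; rewrite exprBn mulr_sumr; apply: eq_bigr => i _.
  by rewrite expr1n mulr1 exprD (exprM _ 2) -mulr_natr; ring.
rewrite exchange_big /=; apply: eq_bigr => i _.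
by rewrite -mulr_sumr sum_teich // addn_gt0 (ltnW n_gt1).
Qed.

(** [teich x ^+ n] is exactly the character of x, but [teich x ^+ 2 - 1] is in general no
    Teichmueller representative, so [qchar_lift] supplies the character of x^2 - 1. *)
Lemma jacobsthal_lift :
  2 * (@jacobsthal 'F_p n 1)%:~R = 3 * teich_sum n - teich_sum (3 * n).
Proof.
rewrite /jacobsthal rmorph_sum /= !mulr_sumr -sumrB; apply: eq_bigr => x _.
have h := qchar_lift (liftsD (liftsX 2 (lifts_teich x)) liftsN1).
rewrite (qcharM card_FpE) rmorphM /= -teich_half.
by apply: (lincomb1 (c := - teich x ^+ n) h); ring.
Qed.

(** * The Jacobsthal sum in terms of [F], for p = 4m + 1 *)

Section OneModFour.
Variable m : nat.
Hypothesis n_even : n = (2 * m)%N.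

Let m_gt0 : (0 < m)%N. Proof. by move: n_gt1; lia. Qed.

Let sign_m k : odd k -> (-1) ^+ (k * m) = (-1) ^+ m :> K.
Proof. by move=> hk; rewrite -signr_odd oddM hk signr_odd. Qed.

(** The exponents run from 2m to 6m, and only 4m is a multiple of p - 1 = 4m. *)
Lemma teich_sum1 : teich_sum n = (p%:R - 1) * (-1) ^+ m * 'C(2 * m, m)%:R.
Proof.
have hd i : (i <= 2 * m)%N -> (2 * n %| n + 2 * (2 * m - i))%N = (i == m).
  move=> hi; rewrite n_even; apply/idP/eqP => [/dvdnP[k]|->]; last first.
    by apply/dvdnP; exists 1%N; lia.
  case: k => [|[|k]]; by rewrite ?mulSn ?mul0n; lia.
rewrite [in teich_sum _]n_even teich_sumE.
have hm : (m < (2 * m).+1)%N by lia.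
rewrite (bigD1 (Ordinal hm)) //= big1 => [|i hi].
  by rewrite hd ?eqxx; [ring|lia].
rewrite hd; last by rewrite -ltnS.
by rewrite -val_eqE /= in hi; rewrite (negbTE hi) mulr0.
Qed.

(** The exponents run from 2m to 14m; the multiples 4m, 8m, 12m of p - 1 come from i = 5m, 3m, m. *)
Lemma teich_sum3 : teich_sum (3 * n)
  = (p%:R - 1) * (-1) ^+ m * (2 * 'C(6 * m, m)%:R + 'C(6 * m, 3 * m)%:R).
Proof.
have hd i : (i <= 6 * m)%N -> (2 * n %| n + 2 * (6 * m - i))%N
    = [|| i == m, i == 3 * m | i == 5 * m]%N.
  move=> hi; rewrite n_even; apply/idP/idP => [/dvdnP[k]|].
    case: k => [|[|[|[|k]]]]; by rewrite ?mulSn ?mul0n; lia.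
  case/or3P => /eqP ->; apply/dvdnP.
  - by exists 3%N; lia.
  - by exists 2%N; lia.
  by exists 1%N; lia.
rewrite teich_sumE (_ : 3 * n = 6 * m)%N; last by rewrite n_even; lia.
have h1 : (m < (6 * m).+1)%N by lia.
have h3 : (3 * m < (6 * m).+1)%N by lia.
have h5 : (5 * m < (6 * m).+1)%N by lia.
rewrite (bigD1 (Ordinal h1)) //= (bigD1 (Ordinal h3)) /=; last by rewrite -val_eqE /=; lia.
rewrite (bigD1 (Ordinal h5)) /=; last by rewrite -!val_eqE /=; lia.
rewrite big1 => [|i /andP[/andP[]]]; last first.
  rewrite -!val_eqE /= => i1 i3 i5; rewrite hd; last by rewrite -ltnS.
  by rewrite (negbTE i1) (negbTE i3) (negbTE i5) mulr0.
rewrite !hd ?eqxx ?orbT /=; try lia.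
rewrite !sign_m // (_ : 'C(6 * m, 5 * m) = 'C(6 * m, m)); first by ring.
by rewrite -(@bin_sub (6 * m) m); [congr 'C(_, _); lia|lia].
Qed.

(** With B = C(2m,m), C(6m,m) is a multiple of B, and C(6m,3m) B = -2p. Hence C(6m,3m) has square 0
    and enters the square only through its cross term with 2B, which is 8p; [F] 2^n = B then brings
    in [F]. *)
Lemma jacobsthal_sqr : ((@jacobsthal 'F_p n 1)%:~R : K) ^+ 2 = F ^+ 2 + 2 * p%:R.
Proof.
have hJ := jacobsthal_lift; rewrite teich_sum1 teich_sum3 in hJ.
set J := (jacobsthal n 1)%:~R in hJ *; set Q : K := 2 ^+ (p - 1).
have h1 := bin_6m_m n_even; have h3 := bin_6m_3m n_even.
have hF := sqbinp1_even n_even; rewrite [in 'C(n, m)]n_even in hF.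
set B := 'C(2 * m, m)%:R in hJ h1 h3 hF.
set C1 := 'C(6 * m, m)%:R in h1 hJ; set C3 := 'C(6 * m, 3 * m)%:R in h3 hJ.
have [|z hz] := @fermat_expr 2; first by rewrite gtnNdvd // p_eq; lia.
have hQ : 2 ^+ n * 2 ^+ n = 1 + p%:R * z :> K.
  by rewrite -hz -exprD; congr (_ ^+ _); rewrite p_eq; lia.
have uB : B \is a GRing.unit.
  have hm : (m <= 2 * m)%N by lia.
  have : ((2 * m)`!%:R : K) \is a GRing.unit by rewrite unit_fact // p_eq n_even; lia.
  by rewrite -(bin_fact hm) natrM unitrM => /andP[].
have hC3 : C3 ^+ 2 = 0.
  apply: (mulIr uB); apply: (mulIr uB).
  by apply: (lincomb2 (c1 := C3 * B - 2 * p%:R) (c2 := 4) h3 psq0); ring.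
have hF2 : F ^+ 2 = (1 - p%:R * z) * B ^+ 2.
  apply: (lincomb3 (c1 := (1 - p%:R * z) * (F * 2 ^+ n + B))
    (c2 := - (1 - p%:R * z) * F ^+ 2) (c3 := z ^+ 2 * F ^+ 2) hF hQ psq0).
  by ring.
have s2 : (-1) ^+ m * (-1) ^+ m = 1 :> K by rewrite -exprMn mulrNN mulr1 expr1n.
have hJ' : 2 * J = (p%:R - 1) * (-1) ^+ m * (2 * B - p%:R * z * B + 2 * p%:R * B - C3).
  rewrite hJ.
  apply: (lincomb3 (c1 := - (p%:R - 1) * (-1) ^+ m)
    (c2 := (p%:R - 1) * (-1) ^+ m * (2 * p%:R - 1) * B)
    (c3 := 2 * z * B * (p%:R - 1) * (-1) ^+ m) h1 hz psq0).
  by ring.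
have u4 : (4 : K) \is a GRing.unit.
  by rewrite (_ : 4 = 2 * 2); [rewrite unitrM !unit2|ring].
apply: (mulrI u4).
set V := 2 * B - p%:R * z * B + 2 * p%:R * B - C3 in hJ'.
have -> : 4 * J ^+ 2 = (1 - 2 * p%:R) * V ^+ 2.
  apply: (lincomb3 (c1 := 2 * J + (p%:R - 1) * (-1) ^+ m * V)
    (c2 := (p%:R - 1) ^+ 2 * V ^+ 2) (c3 := V ^+ 2) hJ' s2 psq0).
  by ring.
have hV : V ^+ 2 = (4 - 4 * p%:R * z + 8 * p%:R) * B ^+ 2 + 8 * p%:R.
  apply: (lincomb3 (c1 := - 2 * (2 - p%:R * z + 2 * p%:R)) (c2 := 1)
    (c3 := B ^+ 2 * (z ^+ 2 + 4 - 4 * z) + 8 - 4 * z) h3 hC3 psq0).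
  by rewrite /V; ring.
rewrite hV hF2.
apply: (lincomb1 (c := B ^+ 2 * (8 * z - 16) - 16) psq0); ring.
Qed.

End OneModFour.

End ModuloSquare.

(** * Reduction of rationals modulo p^2 *)

Section Reduction.
Variable p : nat.
Hypothesis p_prime : prime p.

Local Notation Zp2 := 'Z_(p ^ 2).

Let p2_gt1 : (1 < p ^ 2)%N.
Proof. by rewrite -[1%N](exp1n 2) ltn_exp2r // prime_gt1. Qed.

Lemma psq0_Zp2 : p%:R ^+ 2 = 0 :> Zp2.
Proof. by rewrite -natrX pchar_Zp. Qed.

Lemma unit_nat_Zp2 k : ~~ (p %| k)%N -> (k%:R : Zp2) \is a GRing.unit.
Proof. by move=> hk; rewrite unitZpE // coprime_pexpl // prime_coprime. Qed.

Lemma intr_Zp2_eq0 (a : int) : a%:~R = 0 :> Zp2 -> exists c : int, a = (p ^ 2)%N%:R * c.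
Proof.
move=> ha; have : (`|a|%N)%:R = 0 :> Zp2.
  case: (intP a) ha => [//|k|k] /=; rewrite ?rmorphN /= ?abszN // => /eqP.
  by rewrite oppr_eq0 => /eqP.
move=> /(congr1 val) /=; rewrite val_Zp_nat // => /eqP /dvdnP[c hc].
exists (sgz a * c%:Z); rewrite [LHS]intEsg hc PoszM natz; ring.
Qed.

(* [reduces q y]: the rational [q] is integral at [p], with residue [y] *)
Definition reduces (q : rat) (y : Zp2) := exists (a : int) (b : nat),
  [/\ ~~ (p %| b)%N, q * b%:R = a%:~R & y * b%:R = a%:~R].

Lemma reduces_int a : reduces a%:~R a%:~R.
Proof. by exists a, 1%N; rewrite !mulr1 gtnNdvd // prime_gt1. Qed.

Lemma reduces_nat k : reduces k%:R k%:R.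
Proof. by have := reduces_int k; rewrite -!pmulrn. Qed.

Lemma reducesD q1 q2 y1 y2 : reduces q1 y1 -> reduces q2 y2 -> reduces (q1 + q2) (y1 + y2).
Proof.
move=> [a1 [b1 [h1 e1 f1]]] [a2 [b2 [h2 e2 f2]]].
exists (a1 * b2%:Z + a2 * b1%:Z), (b1 * b2)%N.
rewrite Euclid_dvdM // negb_or h1 h2 !natrM !rmorphD !rmorphM /= -e1 -e2 -f1 -f2 -!pmulrn.
by split=> //; ring.
Qed.

Lemma reducesM q1 q2 y1 y2 : reduces q1 y1 -> reduces q2 y2 -> reduces (q1 * q2) (y1 * y2).
Proof.
move=> [a1 [b1 [h1 e1 f1]]] [a2 [b2 [h2 e2 f2]]].
exists (a1 * a2), (b1 * b2)%N.
rewrite Euclid_dvdM // negb_or h1 h2 !natrM !rmorphM /= -e1 -e2 -f1 -f2.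
by split=> //; ring.
Qed.

Lemma reducesB q1 q2 y1 y2 : reduces q1 y1 -> reduces q2 y2 -> reduces (q1 - q2) (y1 - y2).
Proof.
move=> h1 h2; rewrite -[- q2]mulN1r -[- y2]mulN1r.
by apply: reducesD => //; apply: reducesM => //; exact: (reduces_int (-1)).
Qed.

Lemma reducesX q y k : reduces q y -> reduces (q ^+ k) (y ^+ k).
Proof.
move=> h; elim: k => [|k IH]; first exact: (reduces_nat 1).
by rewrite !exprS; apply: reducesM.
Qed.

(** The denominator of c in lowest terms divides b. *)
Lemma p_integralP c (a : int) b : ~~ (p %| b)%N -> c * b%:R = a%:~R -> p_integral p c.
Proof.
move=> hb e; apply: contra hb => hp; apply: dvdn_trans hp _.
have h : numq c * b%:Z = a * denq c.
  apply: (@intr_inj rat); rewrite !rmorphM /= -e -pmulrn numqE; ring.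
have : (`|denq c| %| `|numq c| * b)%N.
  by have := congr1 absz h; rewrite !abszM => ->; apply: dvdn_mull.
by rewrite Gauss_dvdr // coprime_sym coprime_num_den.
Qed.

(** The factor d clears denominators, so that congruences can be checked with integer
    coefficients. *)
Lemma reduces0_congr d q1 q2 : ~~ (p %| d)%N -> reduces (d%:R * (q1 - q2)) 0 ->
  rat_congr p 2 q1 q2.
Proof.
move=> hd [a [b [hb e]]]; rewrite mul0r => /esym /intr_Zp2_eq0[c hc].
have hdb : ~~ (p %| d * b)%N by rewrite Euclid_dvdM // negb_or hd.
have db0 : (d * b)%N%:R != 0 :> rat.
  by rewrite pnatr_eq0; apply: contra hdb => /eqP ->; rewrite dvdn0.
exists (c%:~R / (d * b)%N%:R); split.
  by apply: (@p_integralP _ c _ hdb); rewrite mulfVK.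
apply: (mulIf db0); rewrite -mulrA mulfVK //.
transitivity (d%:R * (q1 - q2) * b%:R); first by rewrite natrM; ring.
by rewrite e hc rmorphM rmorph_nat.
Qed.

End Reduction.

(** * From identities in Z/p^2 to congruences between rationals *)

Section Transfer.
Variables p n : nat.
Hypotheses (p_prime : prime p) (p_eq : p = (2 * n).+1) (n_gt1 : (1 < n)%N).
Local Notation Zp2 := 'Z_(p ^ 2).

Let psq0 := psq0_Zp2 p_prime.
Let unit_nat := unit_nat_Zp2 p_prime.

Lemma dvdp_pow d k : ~~ (p %| d)%N -> ~~ (p %| d ^ k)%N.
Proof. by move=> hd; rewrite Euclid_dvdX // (negbTE hd). Qed.

Lemma reduces_Ssum j : reduces (Ssum j p) (clausen_sum Zp2 n j).
Proof.
have hn : ((p - 1) %/ 2)%N = n by rewrite p_eq; lia.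
rewrite /Ssum hn big_mkord /clausen_sum.
apply: (big_ind2 (@reduces p)) => [|q1 y1 q2 y2|k _]; first exact: (reduces_nat p_prime 0).
  by move=> h1 h2; apply: reducesD.
rewrite -[k%:R ^+ j * _ / _]mulrA -[k%:R ^+ j * _ * _]mulrA.
apply: reducesM => //; first exact/reducesX/reduces_nat.
have hk : (k <= n)%N by rewrite -ltnS.
(* The denominator in [reduces] is a natural number, so the sign of (-8)^k goes to the numerator. *)
exists ((-1) ^+ k * ('C(2 * k, k) ^ 3)%N%:Z), (8 ^ k)%N.
split.
- have h2 : ~~ (p %| 2)%N by rewrite gtnNdvd // p_eq; lia.
  exact/dvdp_pow/(@dvdp_pow 2 3).
- have h8 : (-8) ^+ k != 0 :> rat by rewrite expf_neq0.
  have e8 : (8 ^ k)%N%:R = (-1) ^+ k * (-8) ^+ k :> rat.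
    by rewrite natrX -exprMn; congr (_ ^+ _); ring.
  by rewrite e8 mulrCA mulfVK // rmorphM rmorphXn /= -pmulrn natrX.
have e8 : (8 ^ k)%N%:R = (-1) ^+ k * (-8) ^+ k :> Zp2.
  by rewrite natrX -exprMn; congr (_ ^+ _); ring.
rewrite e8 rmorphM rmorphXn /= -pmulrn natrX.
rewrite -(central_bin_cube p_prime p_eq n_gt1 psq0 unit_nat hk); ring.
Qed.

Lemma congr_odd m : n = (2 * m + 1)%N ->
  rat_congr p 2 (Ssum 2 p) (7 / 27 * p%:R + 1 / 18 * R1 p) /\
  rat_congr p 2 (Ssum 3 p) (- (10 / 81) * p%:R - 2 / 27 * R1 p).
Proof.
move=> hm.
have [s2 s3] := clausen_sums_odd p_prime p_eq n_gt1 psq0 unit_nat hm.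
have nat := reduces_nat p_prime; have red_p := nat p.
have h3 : ~~ (p %| 3)%N by rewrite gtnNdvd // p_eq; lia.
have h2 : ~~ (p %| 2)%N by rewrite gtnNdvd // p_eq; lia.
have hR : reduces (R1 p) ((2 * p%:R + 2 - 2 ^+ (p - 1)) * 'C(n, m)%:R ^+ 2 : Zp2).
  rewrite /R1 (_ : (p - 1) %/ 2 = n)%N; last by rewrite p_eq; lia.
  rewrite (_ : p %/ 4 = m)%N; last by rewrite p_eq hm; lia.
  rewrite natrX natrD natrM.
  apply: reducesM => //; last exact/reducesX/nat.
  apply: reducesB => //; last exact/reducesX/(nat 2).
  by apply: reducesD => //; apply: reducesM.
set R := _ * _ in hR s2 s3.
split.
  (* 54 is the least common multiple of 27 and 18. *)
  apply: (@reduces0_congr _ p_prime 54).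
    by rewrite (_ : 54 = 2 * 3 ^ 3)%N // Euclid_dvdM // negb_or h2 dvdp_pow.
  have -> : 54%:R * (Ssum 2 p - (7 / 27 * p%:R + 1 / 18 * R1 p))
    = 54%:R * Ssum 2 p - (14%:R * p%:R + 3%:R * R1 p) by field.
  have -> : 0 = 54%:R * clausen_sum Zp2 n 2 - (14%:R * p%:R + 3%:R * R) :> Zp2.
    by rewrite s2 subrr.
  apply: reducesB => //; first by apply: reducesM => //; exact: reduces_Ssum.
  by apply: reducesD => //; apply: reducesM.
apply: (@reduces0_congr _ p_prime 81).
  by rewrite (_ : 81 = 3 ^ 4)%N // dvdp_pow.
have -> : 81%:R * (Ssum 3 p - (- (10 / 81) * p%:R - 2 / 27 * R1 p))
  = 81%:R * Ssum 3 p + (10%:R * p%:R + 6%:R * R1 p) by field.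
have -> : 0 = 81%:R * clausen_sum Zp2 n 3 + (10%:R * p%:R + 6%:R * R) :> Zp2.
  by rewrite s3; ring.
apply: reducesD => //; first by apply: reducesM => //; exact: reduces_Ssum.
by apply: reducesD => //; apply: reducesM.
Qed.

Lemma congr_even m (x y : int) : n = (2 * m)%N -> p%:R = x ^+ 2 + 4 * y ^+ 2 ->
  rat_congr p 2 (Ssum 2 p) (10 / 27 * (x%:~R) ^+ 2 - 4 / 9 * p%:R) /\
  rat_congr p 2 (Ssum 3 p) (- (4 / 81) * (x%:~R) ^+ 2 + 4 / 27 * p%:R).
Proof.
move=> hm hx.
have card_F : #|'F_p| = (2 * n).+1 by rewrite card_Fp.
have n_even : ~~ odd n by rewrite hm; lia.
have [j hj] := jacobsthal_mod4 card_F n_even.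
have [g hg] := jacobsthal_sum card_F n_even.
move: hg; rewrite hj; set b := jacobsthal n g => hg.
have half (t : int) : exists i, t = 2 * i \/ t = 2 * i + 1.
  by exists (t %/ 2)%Z; lia.
(* An odd b would make (4j+2)^2 + b^2 odd, but it equals 4p. *)
have [c hc] : exists c, b = 2 * c.
  have [c [->|hb]] := half b; first by exists c.
  exfalso; move: hg; rewrite hb => hg.
  have : 4 * (4 * j ^+ 2 + 4 * j + 1 + c ^+ 2 + c) + 1 = 4 * (2 * n).+1%:R :> int.
    by rewrite -hg; ring.
  by move: (_ + c) => t; rewrite natz; lia.
have hu : p%:R = (2 * j + 1) ^+ 2 + c ^+ 2 :> int.
  have h4 : (4 : int) != 0 by [].
  by apply: (mulfI h4); rewrite {1}p_eq -hg hc; ring.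
have hxo : exists i, x = 2 * i + 1.
  have [i [hxi|]] := half x; last by exists i.
  exfalso; have : (2 * n).+1%:R = 2 * (2 * i ^+ 2 + 2 * y ^+ 2) :> int.
    by rewrite -p_eq hx hxi; ring.
  by move: (_ + 2 * y ^+ 2) => t; rewrite natz; lia.
(* Half of the Jacobsthal sum, 2j + 1, and x are the odd parts of two representations of p, so 4x^2
   is the square of the Jacobsthal sum. *)
have ux : (2 * j + 1) ^+ 2 = x ^+ 2.
  by apply: (two_squares_unique p_prime hu hx) => //; exists j.
have J := jacobsthal_sqr p_prime p_eq n_gt1 psq0 unit_nat hm.
have hF : (sqbinp Zp2 n).[1] ^+ 2 = 4 * (x%:~R) ^+ 2 - 2 * p%:R.
  rewrite -rmorphXn /= -ux.
  apply: (lincomb1 (c := -1) J); rewrite hj.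
  by rewrite rmorphXn !rmorphD !rmorphM /=; ring.
have [s2 s3] := clausen_sums_even p_prime p_eq n_gt1 psq0 unit_nat hm hF.
have nat := reduces_nat p_prime; have red_p := nat p.
have red_x : reduces (x%:~R ^+ 2) ((x%:~R) ^+ 2 : Zp2).
  exact/reducesX/reduces_int.
have h3 : ~~ (p %| 3)%N by rewrite gtnNdvd // p_eq; lia.
split.
  apply: (@reduces0_congr _ p_prime 27).
    by rewrite (_ : 27 = 3 ^ 3)%N // dvdp_pow.
  have -> : 27%:R * (Ssum 2 p - (10 / 27 * (x%:~R) ^+ 2 - 4 / 9 * p%:R))
    = 27%:R * Ssum 2 p - (10%:R * (x%:~R) ^+ 2 - 12%:R * p%:R) by field.
  have -> : 0 = 27%:R * clausen_sum Zp2 n 2 - (10%:R * (x%:~R) ^+ 2 - 12%:R * p%:R) :> Zp2.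
    by rewrite s2 subrr.
  apply: reducesB => //; first by apply: reducesM => //; exact: reduces_Ssum.
  by apply: reducesB => //; apply: reducesM.
apply: (@reduces0_congr _ p_prime 81).
  by rewrite (_ : 81 = 3 ^ 4)%N // dvdp_pow.
have -> : 81%:R * (Ssum 3 p - (- (4 / 81) * (x%:~R) ^+ 2 + 4 / 27 * p%:R))
  = 81%:R * Ssum 3 p + (4%:R * (x%:~R) ^+ 2 - 12%:R * p%:R) by field.
have -> : 0 = 81%:R * clausen_sum Zp2 n 3 + (4%:R * (x%:~R) ^+ 2 - 12%:R * p%:R) :> Zp2.
  by rewrite s3; ring.
apply: reducesD => //; first by apply: reducesM => //; exact: reduces_Ssum.
by apply: reducesB => //; apply: reducesM.
Qed.

End Transfer.

Theorem theorem3p6 (p : nat) :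
  prime p -> (3 < p)%N ->
  (forall x y : int, p%:R = x ^+ 2 + 4 * y ^+ 2 :> int ->
     (p %% 4 = 1)%N ->
     rat_congr p 2 (Ssum 2 p) (10 / 27 * (x%:~R) ^+ 2 - 4 / 9 * p%:R) /\
     rat_congr p 2 (Ssum 3 p) (- (4 / 81) * (x%:~R) ^+ 2 + 4 / 27 * p%:R)) /\
  ((p %% 4 = 3)%N ->
     rat_congr p 2 (Ssum 2 p) (7 / 27 * p%:R + 1 / 18 * R1 p) /\
     rat_congr p 2 (Ssum 3 p) (- (10 / 81) * p%:R - 2 / 27 * R1 p)).
Proof.
move=> p_prime p_gt3; split=> [x y hxy|] hp.
  by apply: (@congr_even p (2 * (p %/ 4)) _ _ _ (p %/ 4) x y) => //; lia.
by apply: (@congr_odd p (2 * (p %/ 4) + 1) _ _ _ (p %/ 4)) => //; lia.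
Qed.
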